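(* For $x\in(0,\pi/4]$ let $U=(\cos^3x+i\sin^3x)\sigma_0\otimes\sigma_0+i\sin x\cos x\,e^{-ix}\sum_{j=1}^3\sigma_j\otimes\sigma_j$. Let $x_0\approx0.1018$ be the (positive) root of $$H(\cos^22x_0,\sin^22x_0)=H(\cos^6x_0+\sin^6x_0,\cos^2x_0\sin^2x_0,\cos^2x_0\sin^2x_0,\cos^2x_0\sin^2x_0).$$ (i) If $0<x\le x_0$, then $K_E(U)=H(\cos^22x,\sin^22x)$ ebits, attained by the input state $|00\rangle_{AR_A}\otimes|11\rangle_{BR_B}$. (ii) If $x_0\le x\le\pi/4$, then $K_E(U)=H(\cos^6x+\sin^6x,\cos^2x\sin^2x,\cos^2x\sin^2x,\cos^2x\sin^2x)$ ebits, attained by the input state $\frac{1}{\sqrt2}(|00\rangle+|11\rangle)_{AR_A}\otimes\frac{1}{\sqrt2}(|00\rangle+|11\rangle)_{BR_B}$.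
   Context: Pauli matrices: $\sigma_0=I$, $\sigma_1=\begin{pmatrix}0&1\\1&0\end{pmatrix}$, $\sigma_2=\begin{pmatrix}0&-i\\i&0\end{pmatrix}$, $\sigma_3=\begin{pmatrix}1&0\\0&-1\end{pmatrix}$; $U$ acts on qubits $A,B$. The entangling power is $K_E(U)=\max E\big(U(|\phi\rangle_{AR_A}\otimes|\psi\rangle_{BR_B})\big)$, the maximum over pure states on $AR_A$ and $BR_B$ with arbitrary finite-dimensional ancillas $R_A,R_B$ ($U$ acting on $A,B$), where $E(|\chi\rangle)=S(\mathrm{Tr}_{AR_A}|\chi\rangle\langle\chi|)$ is the von Neumann entropy, base-2 logarithm (ebits). $H(p_1,\dots,p_k)=-\sum_ip_i\log_2p_i$ is the Shannon entropy. *)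

(* Defs.v *)
From HB Require Import structures.
From mathcomp Require Import all_boot all_order all_algebra.
From mathcomp Require Import boolp classical_sets reals ereal.
From mathcomp Require Import exp trigo.
From mathcomp Require Export complex.
Set Implicit Arguments. Unset Strict Implicit. Unset Printing Implicit Defensive.
Import Order.TTheory GRing.Theory Num.Theory.
Local Open Scope ring_scope.
Local Open Scope classical_set_scope.
Local Open Scope complex_scope.
Local Open Scope ring_scope.

Definition log2 {R : realType} (t : R) : R := ln t / ln 2.
Definition xlog2x {R : realType} (t : R) : R := if t == 0 then 0 else t * log2 t.
Definition shannon {R : realType} (s : seq R) : R := - \sum_(p <- s) xlog2x p.

Definition adjmx {R : rcfType} {m n : nat} (A : 'M[R[i]]_(m, n)) : 'M[R[i]]_(n, m) :=
  (map_mx (@conjc R) A)^T.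

Definition sigma1 {R : rcfType} : 'M[R[i]]_2 :=
  \matrix_(i < 2, j < 2) (if i != j then 1 else 0).
Definition sigma2 {R : rcfType} : 'M[R[i]]_2 :=
  \matrix_(i < 2, j < 2)
    (if (i == 0 :> nat) && (j == 1 :> nat) then - 'i
     else if (i == 1 :> nat) && (j == 0 :> nat) then 'i else 0).
Definition sigma3 {R : rcfType} : 'M[R[i]]_2 :=
  \matrix_(i < 2, j < 2)
    (if i == j then (if (i == 0 :> nat) then 1 else -1) else 0).
Definition pauli {R : rcfType} (j : 'I_3) : 'M[R[i]]_2 :=
  match val j with 0 => sigma1 | 1 => sigma2 | _ => sigma3 end.

(* A two-qubit operator on A (x) B, given by its matrix entries
   U a b a' b' = <a b| U |a' b'> (a, a' index qubit A; b, b' index qubit B). *)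
Definition twoq (R : rcfType) := 'I_2 -> 'I_2 -> 'I_2 -> 'I_2 -> R[i].

Definition Uop {R : realType} (x : R) : twoq R := fun a b a' b' =>
  (cos x ^+ 3 +i* sin x ^+ 3) * ((1%:M : 'M[R[i]]_2) a a' * (1%:M : 'M[R[i]]_2) b b')
  + 'i * (sin x * cos x)%:C * (cos x -i* sin x)
    * \sum_(j < 3) (pauli j a a' * pauli j b b').

(* Pure states: |phi>_{A R_A} = sum_{a,r} phi a r |a>|r>, phi : 'M_(2, m). *)
Definition normalized {R : rcfType} {m : nat} (phi : 'M[R[i]]_(2, m)) : Prop :=
  \sum_(a < 2) \sum_(r < m) phi a r * conjc (phi a r) = 1.

Definition out {R : rcfType} {m n : nat} (U : twoq R)
  (phi : 'M[R[i]]_(2, m)) (psi : 'M[R[i]]_(2, n)) a r b s : R[i] :=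
  \sum_(a' < 2) \sum_(b' < 2) U a b a' b' * phi a' r * psi b' s.

(* reduced density matrix on B R_B : Tr_{A R_A} |chi><chi| , with the basis of
   B R_B indexed through mxvec_index. *)
Definition rhoB {R : rcfType} {m n : nat} (U : twoq R)
  (phi : 'M[R[i]]_(2, m)) (psi : 'M[R[i]]_(2, n)) : 'M[R[i]]_(2 * n) :=
  \sum_(a < 2) \sum_(r < m)
    let v := mxvec (\matrix_(b < 2, s < n) out U phi psi a r b s) in
    v^T *m map_mx (@conjc R) v.

Definition vn_entropy_is {R : realType} {k : nat} (rho : 'M[R[i]]_k) (e : R) : Prop :=
  exists (V : 'M[R[i]]_k) (lam : 'rV[R]_k),
    V *m adjmx V = 1%:M /\
    rho = V *m diag_mx (map_mx (fun t : R => t%:C) lam) *m adjmx V /\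
    e = shannon [seq lam 0 i | i <- enum 'I_k].

(* entanglement values reachable with product inputs, arbitrary finite ancillas *)
Definition achievable {R : realType} (U : twoq R) : set R :=
  [set e | exists (m n : nat) (phi : 'M[R[i]]_(2, m)) (psi : 'M[R[i]]_(2, n)),
     normalized phi /\ normalized psi /\ vn_entropy_is (rhoB U phi psi) e].

Definition KE {R : realType} (U : twoq R) : \bar R :=
  ereal_sup [set (e%:E : \bar R) | e in achievable U].

Definition H2 {R : realType} (x : R) : R :=
  shannon [:: cos (2 * x) ^+ 2; sin (2 * x) ^+ 2].
Definition H4 {R : realType} (x : R) : R :=
  shannon [:: cos x ^+ 6 + sin x ^+ 6; cos x ^+ 2 * sin x ^+ 2;
              cos x ^+ 2 * sin x ^+ 2; cos x ^+ 2 * sin x ^+ 2].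

Definition ket00 {R : rcfType} : 'M[R[i]]_(2, 2) := delta_mx ord0 ord0.
Definition ket11 {R : rcfType} : 'M[R[i]]_(2, 2) := delta_mx ord_max ord_max.
Definition bell {R : rcfType} : 'M[R[i]]_(2, 2) :=
  (Num.sqrt (1 / 2 : R))%:C *: (delta_mx ord0 ord0 + delta_mx ord_max ord_max).

(* Main.v *)
Require Import Defs.
From HB Require Import structures.
From mathcomp Require Import all_boot all_order all_algebra.
From mathcomp Require Import boolp classical_sets reals ereal.
From mathcomp Require Import topology normedtype derive realfun.
From mathcomp Require Import exp trigo.
From mathcomp Require Import complex spectral sesquilinear ring lra.
Import Order.TTheory GRing.Theory Num.Theory.
Import numFieldNormedType.Exports.
Local Open Scope ring_scope.
Set Implicit Arguments. Unset Strict Implicit. Unset Printing Implicit Defensive.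

(** Up to the phase [e^(-ix)], [U = cos 2x + i sin 2x SWAP]; write [s = sin^2 2x].

    The entropy of a state is at most the Shannon entropy of its diagonal in any
    orthonormal frame. Take an eigenbasis [x_k] of the reduced input state of B,
    with eigenvalues [b_k], the matching Schmidt vectors [y_l] of R_B, and let
    [a_k] be the diagonal in [x_k] of the reduced input state of A. In the frame
    [x_0 y_1], [x_1 y_0] together with the eigenvectors of the compression of the
    output to the span of [x_0 y_0], [x_1 y_1], the diagonal of the output is
    [s u], [s v], [l], [m] with [u = a_0 b_1], [v = a_1 b_0],
    [l + m = 1 - s (u + v)] and [l m = s (4 - 3 s) u v].

    If [u + v <= 1/2], then [l >= 1 - 3s/4] and Gibbs' inequality against
    [(1 - 3s/4, s/4, s/4, s/4)] bounds the entropy by H4. Otherwise, increasing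
    [u v] at fixed [u + v] only increases the entropy, so
    [u, v = (1 +- p)^2 / 4]. For [s >= 3/10] Gibbs' inequality still gives H4; for
    [s <= 3/10] the entropy lies below the chord [(1 - p^2) H4 + p^2 H2].

    Finally [(H4 - H2) / s] is nondecreasing in [s], so H2 and H4 cross only once. *)

(** * Logarithm inequalities *)

Section Calculus.
Context {R : realType}.
Implicit Types x y z s : R.

Lemma ler_is_derive (f f' : R -> R) (a b : R) : a <= b ->
  (forall x, a <= x <= b -> is_derive x 1 f (f' x)) ->
  (forall x, a <= x <= b -> 0 <= f' x) -> f a <= f b.
Proof.
move=> ab df f'0.
have cf : {within `[a, b], continuous f}%classic.
  apply: derivable_within_continuous => x; rewrite in_itv/= => xab.
  by have [] := df x xab.
have [|c cab E] := @MVT_segment R f f' a b ab _ cf.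
  by move=> x; rewrite in_itv/= => /andP[ax xb]; apply: df; rewrite !ltW.
rewrite -subr_ge0 E mulr_ge0 ?subr_ge0 ?f'0//.
Qed.

Lemma ln_le_subr1 x : 0 < x -> ln x <= x - 1.
Proof.
move=> x0; have := @le_ln1Dx R (x - 1); rewrite addrCA subrr addr0; apply; lra.
Qed.

Lemma ln_ge_sub1V x : 0 < x -> 1 - x^-1 <= ln x.
Proof.
by move=> x0; have := @ln_le_subr1 x^-1; rewrite invr_gt0 lnV ?posrE// => /(_ x0); lra.
Qed.

(** The rational side is the [1/1] Padé approximant of [ln] at 1; the difference of the two sides
    has derivative [(t - 1)^2 / (t (t + 1)^2)]. *)
Lemma ln_ge_pade x : 1 <= x -> 2 * (x - 1) / (x + 1) <= ln x.
Proof.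
move=> x1; rewrite -subr_ge0.
pose f (t : R) : R := ln t + 4 * (t + 1)^-1.
suff : f 1 <= f x.
  rewrite /f ln1 add0r; have -> : 4 * (1 + 1)^-1 = 2 :> R by field.
  have -> : 2 * (x - 1) / (x + 1) = 2 - 4 * (x + 1)^-1 by field; lra.
  lra.
apply: (@ler_is_derive f (fun t => t^-1 - 4 * (t + 1) ^- 2)) => // t /andP[t1 tx].
  have t0 : 0 < t by lra.
  have ? := is_derive1_ln t0.
  have t10 : t + 1 != 0 by lra.
  have ? : is_derive t 1 (fun t => (t + 1)^-1 : R) (- (t + 1) ^- 2 *: (1 + 0 : R)).
    exact: is_deriveV.
  rewrite /f. apply: is_derive_eq.
  rewrite /GRing.scale /=. lra.
rewrite (_ : _ - _ = (t - 1) ^+ 2 / (t * (t + 1) ^+ 2)); last by field; apply/andP; split; lra.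
by rewrite divr_ge0 ?sqr_ge0// mulr_ge0 ?sqr_ge0//; lra.
Qed.

(** The difference of the two sides has derivative [(1 - 1/t)^2]. *)
Lemma ln_le_halfBV x : 1 <= x -> 2 * ln x <= x - x^-1.
Proof.
move=> x1; rewrite -subr_ge0.
pose f (t : R) : R := t - t^-1 - 2 * ln t.
suff : f 1 <= f x.
  by rewrite /f ln1 invr1; lra.
apply: (@ler_is_derive f (fun t => 1 + t ^- 2 - 2 * t^-1)) => // t /andP[t1 tx].
  have t0 : 0 < t by lra.
  have ? := is_derive1_ln t0.
  have t10 : t != 0 by lra.
  have ? : is_derive t 1 (fun t => t^-1 : R) (- t ^- 2 *: (1 : R)).
    exact: is_deriveV.
  rewrite /f. apply: is_derive_eq.
  rewrite /GRing.scale /=. lra.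
rewrite (_ : _ - _ = (t - 1) ^+ 2 / t ^+ 2); last by field; lra.
by rewrite divr_ge0 ?sqr_ge0.
Qed.

(** Factoring 2 keeps the arguments near 1, where both bounds are sharp: [4/3 * 3/2] gives
    [2/7 + 2/5] from below, and [4/3 * 5/4 * 6/5] gives exactly [7/10] from above. *)
Lemma ln2_bounds : 48 / 70 <= ln 2 :> R /\ ln 2 <= 7 / 10 :> R.
Proof.
have p3 : (0 < 4 / 3 :> R) /\ (0 < 3 / 2 :> R) by split; lra.
have p4 : (0 < 5 / 4 :> R) /\ (0 < 6 / 5 :> R) by split; lra.
have E1 : ln 2 = ln (4 / 3) + ln (3 / 2) :> R.
  by rewrite -lnM ?posrE; try lra; congr ln; field.
have E2 : ln (3 / 2) = ln (5 / 4) + ln (6 / 5) :> R.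
  by rewrite -lnM ?posrE; try lra; congr ln; field.
have a1 := @ln_ge_pade (4 / 3) ltac:(lra).
have a2 := @ln_ge_pade (3 / 2) ltac:(lra).
have b1 := @ln_le_halfBV (4 / 3) ltac:(lra).
have b2 := @ln_le_halfBV (5 / 4) ltac:(lra).
have b3 := @ln_le_halfBV (6 / 5) ltac:(lra).
rewrite !invf_div in b1 b2 b3.
have e1 : 2 * (4 / 3 - 1) / (4 / 3 + 1) = 2 / 7 :> R by field; lra.
have e2 : 2 * (3 / 2 - 1) / (3 / 2 + 1) = 2 / 5 :> R by field; lra.
split; lra.
Qed.

End Calculus.

(** * Entropy of the four eigenvalues *)

Section Entropy.
Context {R : realType}.
Implicit Types x y z s t u v l m p : R.

Definition ent t := - (t * ln t).

Lemma ent0 : ent 0 = 0. Proof. by rewrite /ent mul0r oppr0. Qed.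

(** Concavity: the right-hand side is the tangent of [ent] at [u]. Summed over two distributions of
    equal mass, it is Gibbs' inequality. *)
Lemma ent_le_tangent t u : 0 <= t -> 0 < u -> ent t <= - (t * ln u) + u - t.
Proof.
move=> t0 u0; have [->|tN0] := eqVneq t 0; first by rewrite ent0; lra.
have tp : 0 < t by rewrite lt_def tN0.
have ut : 0 < u / t by rewrite divr_gt0.
have := ln_le_subr1 ut; rewrite ln_div ?posrE// => /(ler_wpM2l t0).
rewrite /ent [t * (u / t - 1)](_ : _ = u - t); last by field.
by lra.
Qed.

(** The tangent at the mean [r] leaves the remainder [r (sum w - 1)], which is nonpositive, so
    weights of mass below 1 are allowed. The rows of a partial isometry supply such weights. *)
Lemma ent_jensen (I : finType) (w lam : I -> R) :
  (forall i, 0 <= w i) -> (forall i, 0 <= lam i) -> \sum_i w i <= 1 ->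
  \sum_i w i * ent (lam i) <= ent (\sum_i w i * lam i).
Proof.
move=> w0 l0 w1; set r := \sum_i w i * lam i.
have r0 : 0 <= r by apply: sumr_ge0 => i _; rewrite mulr_ge0.
have [rE|rN0] := eqVneq r 0.
  rewrite rE ent0 big1// => i _.
  have /eqP := rE; rewrite /r psumr_eq0; last by move=> j _; rewrite mulr_ge0.
  by move=> /allP /(_ i); rewrite mem_index_enum /ent mulrN mulrA => /(_ isT)/implyP/(_ isT)/eqP ->; rewrite mul0r oppr0.
have rp : 0 < r by rewrite lt_def rN0.
apply: (@le_trans _ _ (\sum_i w i * (- (lam i * ln r) + r - lam i))).
  by apply: ler_sum => i _; rewrite ler_wpM2l// ent_le_tangent.
rewrite (_ : \sum_i _ = - (r * ln r) + r * \sum_i w i - r); last first.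
  rewrite /r mulr_suml -sumrN mulr_sumr -big_split/= -sumrB; apply: eq_bigr => i _.
  by rewrite -/r; ring.
rewrite /ent -addrA gerDl subr_le0; apply: ler_piMr => //.
Qed.

Lemma ent_jensen2 c x y : 0 <= c <= 1 -> 0 <= x -> 0 <= y ->
  c * ent x + (1 - c) * ent y <= ent (c * x + (1 - c) * y).
Proof.
move=> /andP[c0 c1] x0 y0.
have := @ent_jensen bool (fun b => if b then c else 1 - c) (fun b => if b then x else y).
rewrite !big_bool/=; apply => [[]|[]|]; lra.
Qed.

(** Equal sums and a larger product put [x'] and [y'] between [x] and [y]; both are convex
    combinations of [x] and [y] with exchanged weights, and concavity concludes. *)
Lemma ent_two_point x y x' y' : 0 <= x -> 0 <= y -> 0 <= x' -> 0 <= y' ->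
  x + y = x' + y' -> x * y <= x' * y' -> ent x + ent y <= ent x' + ent y'.
Proof.
wlog xy : x y / x <= y.
  move=> H x0 y0 x'0 y'0 e1 e2; have [xy|/ltW yx] := leP x y; first exact: H.
  by rewrite addrC; apply: H => //; [rewrite addrC|rewrite mulrC].
wlog xy' : x' y' / x' <= y'.
  move=> H x0 y0 x'0 y'0 e1 e2; have [?|/ltW ?] := leP x' y'; first exact: H.
  by rewrite (addrC (ent x')); apply: H => //; [rewrite (addrC y')|rewrite (mulrC y')].
move=> x0 y0 x'0 y'0 e1 e2.
(* The weight [c] below divides by [y - x]. When [x = y] the product is already maximal for its sum,
   so nothing moves. *)
have [E|xNy] := eqVneq x y.
  have ? : x' = y' by nra.
  have ? : x = x' by lra.
  by subst; lra.
have xlty : x < y by rewrite lt_def eq_sym xNy.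
have xx' : x <= x' by nra.
pose c := (y - x') / (y - x).
have c01 : 0 <= c <= 1.
  rewrite /c divr_ge0 ?subr_ge0 ?ler_pdivrMr ?subr_gt0 ?mul1r/=; lra.
have c01' : 0 <= 1 - c <= 1 by lra.
have ex : x' = c * x + (1 - c) * y by rewrite /c; field; lra.
have ey : y' = (1 - c) * x + (1 - (1 - c)) * y by lra.
have := ent_jensen2 c01 x0 y0; rewrite -ex.
have := ent_jensen2 c01' x0 y0; rewrite -ey.
lra.
Qed.

(* H2 and H4 in nats, as functions of [s = sin^2 2x]. *)
Definition entH2 s := ent (1 - s) + ent s.
Definition entH4 s := ent (1 - 3 / 4 * s) + 3 * ent (s / 4).

(** The value at [mu] of the monic quadratic with roots [l] and [m] is [mu s (u + v + 4 u v - 3/4)],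
    nonpositive, so [mu <= l]. The tangents at [(mu, d, d, d)] then sum to
    [entH4 s - (l - mu) (ln mu - ln d)]. *)
Lemma entropy_le_H4_inner s u v l m : 0 < s <= 1 -> 0 <= u -> 0 <= v ->
  0 <= m -> m <= l -> l + m = 1 - s * (u + v) -> l * m = s * (4 - 3 * s) * (u * v) ->
  u + v + 4 * (u * v) <= 3 / 4 ->
  ent (s * u) + ent (s * v) + ent l + ent m <= entH4 s.
Proof.
move=> /andP[s0 s1] u0 v0 m0 ml S P H.
set mu := 1 - 3 / 4 * s; set d := s / 4.
have d0 : 0 < d by rewrite /d; lra.
have mu0 : 0 < mu by rewrite /mu; lra.
have mul : mu <= l.
  have E : (mu - l) * (mu - m) = mu * s * (u + v + 4 * (u * v) - 3 / 4).
    rewrite (_ : (mu - l) * (mu - m) = mu * (mu - (l + m)) + l * m); last by ring.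
    by rewrite S P /mu; field.
  have : (mu - l) * (mu - m) <= 0 by rewrite E; apply: mulr_ge0_le0; [rewrite mulr_ge0 ?ltW|lra].
  by rewrite leNgt => /negP H1; rewrite leNgt; apply/negP => lmu; apply: H1; rewrite mulr_gt0 ?subr_gt0 // (le_lt_trans ml).
have g1 := @ent_le_tangent (s * u) d ltac:(nra) d0.
have g2 := @ent_le_tangent (s * v) d ltac:(nra) d0.
have g3 := @ent_le_tangent m d m0 d0.
have g4 := @ent_le_tangent l mu ltac:(lra) mu0.
have lnd : ln d <= ln mu by rewrite ler_ln ?posrE// /d /mu; lra.
have := mulr_ge0 (_ : 0 <= l - mu) (_ : 0 <= ln mu - ln d).
rewrite !subr_ge0 => /(_ mul lnd) H1.
rewrite /entH4 -/mu -/d /ent in g1 g2 g3 g4 *.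
have e1 : m * ln d = (1 - s * (u + v) - l) * ln d by congr (_ * _); lra.
have md : mu = 1 - 3 * d by rewrite /mu /d; lra.
have : s * u * ln d + s * v * ln d + m * ln d = (1 - l) * ln d by rewrite e1; ring.
have : 3 * (d * ln d) = (1 - mu) * ln d by rewrite md; ring.
lra.
Qed.

(** What remains of [ent (s u) + ent (s v)] at [u, v = (1 +- p)^2 / 4], up to the factor [- s / 2],
    once [ln (s / 4)] is split off. *)
Definition kfun p := (1 + p) ^+ 2 * ln (1 + p) + (1 - p) ^+ 2 * ln (1 - p).

Lemma sqr_ln_ge p : 0 <= p <= 1 -> - (p * (1 - p)) <= (1 - p) ^+ 2 * ln (1 - p).
Proof.
move=> /andP[p0 p1]; have [->|pN1] := eqVneq p 1; first by rewrite subrr expr0n /=; lra.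
have q0 : 0 < 1 - p by rewrite subr_gt0 lt_def eq_sym pN1.
have := ln_ge_sub1V q0 => /(ler_wpM2l (sqr_ge0 (1 - p))).
by rewrite (_ : _ * (1 - _) = - (p * (1 - p))) //; field; lra.
Qed.

Lemma kfun_ge_rat p : 0 <= p <= 1 -> p ^+ 2 * (5 + 3 * p) / (2 + p) <= kfun p.
Proof.
move=> p01; have := sqr_ln_ge p01; case/andP: p01 => p0 p1.
have := @ln_ge_pade R (1 + p) ltac:(lra) => /(ler_wpM2l (sqr_ge0 (1 + p))).
rewrite /kfun; have -> : (1 + p) ^+ 2 * (2 * (1 + p - 1) / (1 + p + 1)) = p ^+ 2 * (5 + 3 * p) / (2 + p) + p * (1 - p).
  by field; lra.
lra.
Qed.

(** Writing [ln (1 + p) = ln 2 + ln ((1 + p) / 2)] makes the bound an equality at [p = 1]. *)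
Lemma kfun_ge_ln2 p : 0 <= p <= 1 -> (1 + p) ^+ 2 * ln 2 - (1 - p) * (1 + 2 * p) <= kfun p.
Proof.
move=> p01; have := sqr_ln_ge p01; case/andP: p01 => p0 p1.
have q0 : 0 < (1 + p) / 2 by lra.
have := ln_ge_sub1V q0; rewrite ln_div ?posrE; try lra.
move=> /(ler_wpM2l (sqr_ge0 (1 + p))).
rewrite /kfun (_ : _ * (1 - _) = - ((1 - p) * (1 + p))); last by field; lra.
lra.
Qed.

Lemma ent_outer_pair s p : 0 < s -> 0 <= p <= 1 ->
  ent (s * ((1 + p) ^+ 2 / 4)) + ent (s * ((1 - p) ^+ 2 / 4)) =
  - (s * (1 + p ^+ 2) / 2) * ln (s / 4) - s / 2 * kfun p.
Proof.
move=> s0 /andP[p0 p1].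
have F q : 0 <= q -> ent (s * (q ^+ 2 / 4)) = - (s / 4 * q ^+ 2) * ln (s / 4) - s / 2 * (q ^+ 2 * ln q).
  move=> q0; have [->|qN0] := eqVneq q 0; first by rewrite expr0n/= !(mul0r, mulr0) ent0; lra.
  have qp : 0 < q by rewrite lt_def qN0.
  rewrite /ent (_ : s * (q ^+ 2 / 4) = s / 4 * q ^+ 2); last by lra.
  rewrite lnM ?posrE ?exprn_gt0 ?divr_gt0// lnXn//; lra.
rewrite !F ?/kfun; lra.
Qed.

End Entropy.

(** * Outer case [u + v > 1/2]: comparison with H4 *)

Section Outer.
Context {R : realType}.
Implicit Types x y z s t u v l m p : R.

(** The comparison with H4 needs lower bounds on [kfun p - p^2]: the linear one in [p^2] serves for
    [s > 4/5], the quadratic one for [s <= 4/5]. *)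
Lemma kfun_ge_tangent p : 0 <= p <= 1 ->
  p ^+ 2 + 3 / 2 * p ^+ 2 <= kfun p /\ p ^+ 2 + 5 / 3 * (p ^+ 2) ^+ 2 <= kfun p.
Proof.
move=> p01; have := kfun_ge_rat p01; case/andP: p01 => p0 p1 K.
split; apply: le_trans K; rewrite ler_pdivlMr; try lra.
  by rewrite -subr_ge0 (_ : _ - _ = p ^+ 3 / 2); [rewrite divr_ge0 ?exprn_ge0|field].
rewrite -subr_ge0 (_ : _ - _ = p ^+ 2 / 3 * (9 + 6 * p - 10 * p ^+ 2 - 5 * p ^+ 3)); last by field.
rewrite mulr_ge0 ?divr_ge0 ?sqr_ge0//; nra.
Qed.

(** As a function of [p^2], [kfun] has the chord [4 ln 2 p^2] on [[0, 1]]. The rational bound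
    controls the sag up to [p = 7/10], and the bound exact at [p = 1] does so beyond. *)
Lemma kfun_ge_chord p : 0 <= p <= 1 ->
  4 * ln 2 * p ^+ 2 - 39 / 100 * (p ^+ 2 * (1 - p ^+ 2)) <= kfun p.
Proof.
move=> p01; have [a b] := @ln2_bounds R.
have [pl|pl] := leP p (7 / 10).
  apply: le_trans (kfun_ge_rat p01); case/andP: p01 => p0 p1.
  rewrite ler_pdivlMr; last lra.
  apply: (@le_trans _ _ ((4 * (7 / 10) * p ^+ 2 - 39 / 100 * (p ^+ 2 * (1 - p ^+ 2))) * (2 + p))).
    rewrite ler_wpM2r; [by []|lra|].
    by rewrite lerB// ler_wpM2r ?sqr_ge0//; lra.
  rewrite -subr_ge0 (_ : _ - _ = p ^+ 2 * (5 + 3 * p - (4 * (7 / 10) - 39 / 100 * (1 - p ^+ 2)) * (2 + p))); last by field.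
  rewrite mulr_ge0 ?sqr_ge0//; nra.
apply: le_trans (kfun_ge_ln2 p01); case/andP: p01 => p0 p1.
rewrite -subr_ge0 (_ : _ - _ = (1 - p) * (ln 2 * (1 + 3 * p) - 1 - 2 * p + 39 / 100 * (p ^+ 2 * (1 + p)))); last by field.
rewrite mulr_ge0 ?subr_ge0//.
have : 48 / 70 * (1 + 3 * p) <= ln 2 * (1 + 3 * p) by rewrite ler_wpM2r; lra.
have : 0 <= p ^+ 2 * (1 + p) - (7 / 10) ^+ 2 * (17 / 10) by nra.
lra.
Qed.

Lemma root_location s y z l m (mu := 1 - 3 / 4 * s) (d := s / 4) :
  0 < s <= 4 / 5 -> 0 <= y <= 1 -> z = 1 - y -> 0 <= m -> m <= l ->
  l + m = 1 - s * (1 + y) / 2 -> l * m = d * mu * z ^+ 2 ->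
  [/\ m <= d, 1 - s <= l, l <= mu & (mu - l) * (mu - m) = d * mu * y ^+ 2].
Proof.
move=> /andP[s0 s1] /andP[y0 y1] zE m0 ml S P.
have between c : (c - l) * (c - m) <= 0 -> m <= c <= l.
  by move=> H; apply/andP; split; rewrite leNgt; apply/negP => cl; nra.
have expand c : (c - l) * (c - m) = c * (c - (1 - s * (1 + y) / 2)) + d * mu * z ^+ 2.
  by rewrite -S -P; ring.
(* Here and at [1 - s] the extreme value of [y] leaves [1 - 5 s / 4 >= 0], the origin of the
   threshold [4/5]. *)
have /andP[md _] : m <= d <= l.
  apply: between; rewrite expand zE /d /mu.
  rewrite [leLHS](_ : _ = - (s * y / 4 * ((1 - 3 / 4 * s) * (2 - y) - s / 2))); last by field.
  by rewrite oppr_le0 mulr_ge0//; nra.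
have /andP[_ sl] : m <= 1 - s <= l.
  apply: between; rewrite expand /d /mu.
  rewrite [leLHS](_ : _ = - (s * z / 4 * (2 * (1 - s) - (1 - 3 / 4 * s) * z))); last by rewrite zE; field.
  by rewrite oppr_le0 mulr_ge0//; nra.
have E : (mu - l) * (mu - m) = d * mu * y ^+ 2.
  by rewrite expand zE /d /mu; field.
split=> //.
rewrite leNgt; apply/negP => lm.
have : (mu - l) * (mu - m) < 0.
  by rewrite nmulr_rlt0 ?subr_lt0// subr_gt0 /mu; move: md; rewrite /d; lra.
by rewrite E; apply/negP; rewrite -leNgt mulr_ge0 ?sqr_ge0 ?mulr_ge0// /d /mu; lra.
Qed.

(** Tangents at [d] for [m] and at [mu] for [l] reduce the claim to [(mu - l) (ln mu - ln d) <= 2 d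
    (kfun p - p^2)]. The left side is controlled through [(mu - l) (mu - m) = d mu p^4]. *)
Lemma entropy_le_H4_outer s p l m : 3 / 10 <= s <= 1 -> 0 <= p <= 1 ->
  0 <= m -> m <= l -> l + m = 1 - s * (1 + p ^+ 2) / 2 ->
  l * m = s / 4 * (1 - 3 / 4 * s) * (1 - p ^+ 2) ^+ 2 ->
  ent (s * ((1 + p) ^+ 2 / 4)) + ent (s * ((1 - p) ^+ 2 / 4)) + ent l + ent m <= entH4 s.
Proof.
move=> /andP[s03 s1] p01 m0 ml S P.
have [k1 k2] := kfun_ge_tangent p01.
have s0 : 0 < s by lra.
rewrite (ent_outer_pair s0 p01).
set y := p ^+ 2 in k1 k2 S P *; set k := kfun p in k1 k2 *.
have y01 : 0 <= y <= 1.
  by case/andP: p01 => p0 p1; rewrite /y sqr_ge0 expr_le1.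
have /andP[y0 y1] := y01.
set mu := 1 - 3 / 4 * s in P *; set d := s / 4 in P *.
have d0 : 0 < d by rewrite /d; lra.
have mu0 : 0 < mu by rewrite /mu; lra.
have sd : s = 4 * d by rewrite /d; lra.
have mud : mu = 1 - 3 * d by rewrite /mu /d; lra.
suff K : (mu - l) * (ln mu - ln d) <= 2 * d * (k - y).
  have := @ent_le_tangent R m d m0 d0.
  have := @ent_le_tangent R l mu ltac:(lra) mu0.
  rewrite /entH4 -/mu -/d /ent.
  have -> : m * ln d = (1 - s * (1 + y) / 2 - l) * ln d by congr (_ * _); lra.
  have -> : mu * ln mu = l * ln mu + (mu - l) * ln mu by ring.
  have -> : 3 * - (d * ln d) = - ((1 - l) * ln d) + (mu - l) * ln d by rewrite mud; ring.
  have -> : s / 2 = 2 * d by lra.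
  have : s * y = 4 * (d * y) by rewrite sd; ring.
  lra.
have lnd : 0 <= ln mu - ln d by rewrite subr_ge0 ler_ln ?posrE// /d /mu; lra.
have [lmu|lmu] := leP mu l.
  have : (mu - l) * (ln mu - ln d) <= 0 by rewrite mulr_le0_ge0// subr_le0.
  by move/le_trans; apply; rewrite !mulr_ge0 //; lra.
have [s45|s45] := leP s (4 / 5).
  have [|md _ _ E] := root_location (z := 1 - y) _ y01 erefl m0 ml S P; first lra.
  (* Then [ln mu - ln d = 2 ln x <= x - 1/x] and [1 - s = d (x^2 - 1)], so the factor [1 - s]
     cancels and [d x y^2] remains; [x <= 10/3] follows from [s >= 3/10]. *)
  pose x := Num.sqrt (mu / d).
  have xx : d * x ^+ 2 = mu by rewrite sqr_sqrtr ?divr_ge0 ?ltW//; field; lra.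
  have x1 : 1 <= x.
    rewrite -sqrtr1 ler_wsqrtr// ler_pdivlMr// /mu /d; lra.
  have x0 : 0 < x by lra.
  have xb : x <= 10 / 3 by rewrite /mu /d in xx; nra.
  have L : ln mu - ln d <= x - x^-1.
    apply: le_trans (ln_le_halfBV x1).
    by rewrite -xx lnM ?posrE ?exprn_gt0// lnXn//; lra.
  have E' : (mu - l) * (1 - s) <= d * mu * y ^+ 2.
    rewrite -E ler_wpM2l ?subr_ge0 ?(ltW lmu)//; move: md; rewrite /mu /d; lra.
  have sx : 1 - s = d * (x ^+ 2 - 1) by rewrite mulrBr xx /mu /d; lra.
  apply: (@le_trans _ _ ((mu - l) * (x - x^-1))); first by rewrite ler_wpM2l// subr_ge0 ltW.
  apply: (@le_trans _ _ (d * x * y ^+ 2)).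
    rewrite (_ : _ * (x - _) = (mu - l) * (1 - s) / (d * x)); last first.
      by rewrite sx; field; lra.
    rewrite ler_pdivrMr ?mulr_gt0//; apply: le_trans E' _.
    by rewrite -xx le_eqVlt; apply/orP; left; apply/eqP; ring.
  rewrite -mulrA (mulrC 2) -(mulrA d) ler_pM2l//.
  have : x * y ^+ 2 <= 10 / 3 * y ^+ 2 by rewrite ler_wpM2r ?sqr_ge0.
  lra.
have E : (mu - l) * (mu - m) = d * mu * y ^+ 2.
  have -> : (mu - l) * (mu - m) = mu * (mu - (l + m)) + l * m by ring.
  by rewrite S P /mu /d; field.
have L : ln mu - ln d <= (1 - s) / d.
  have md0 : 0 < mu / d by rewrite divr_gt0.
  have := ln_le_subr1 md0; rewrite ln_div ?posrE// => /le_trans; apply.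
  rewrite (_ : mu / d - 1 = (mu - d) / d); last by field; lra.
  by rewrite ler_pM2r ?invr_gt0// /mu /d; lra.
apply: (@le_trans _ _ ((mu - l) * ((1 - s) / d))); first by rewrite ler_wpM2l// subr_ge0 ltW.
apply: (@le_trans _ _ (3 * d * y)); last by nra.
(* The smaller root [m] is at most half of [l + m], and [s > 4/5] gives [s / 4 >= 1 - s]. *)
have W : (1 - s) * (1 / 2 + y) <= mu - m by rewrite /mu; nra.
have : (mu - l) * ((1 - s) * (1 / 2 + y)) <= d * mu * y ^+ 2.
  by rewrite -E ler_wpM2l// subr_ge0 ltW.
move=> H; rewrite mulrA ler_pdivrMr//.
have y2 : 0 < 1 / 2 + y by lra.
rewrite -(ler_pM2r y2) -[leLHS]mulrA; apply: le_trans H _.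
rewrite -subr_ge0 (_ : _ - _ = d * y * (3 * d * (1 / 2 + y) - mu * y)); last by ring.
have : 0 <= (3 * d - mu) * y by rewrite mulr_ge0// mud; lra.
by move=> ?; rewrite mulr_ge0 ?(mulr_ge0 (ltW d0))//; lra.
Qed.

End Outer.

(** * Outer case with [s = 4 d <= 3/10]: comparison with the chord from H4 to H2 *)

Section Outer.
Context {R : realType}.
Implicit Types x y z s t u v l m p : R.

(** Since [l <= mu], [m / d >= (1 - y)^2], whence [- m ln (m / d) <= 2 m y / (1 - y)]. The factor
    [31/28] is the largest value of [(1 - 3 d) / (1 - 4 d)], which bounds [mu / l]. *)
Lemma small_root_ent_le d y l m (mu := 1 - 3 * d) : 0 < d <= 3 / 40 -> 0 <= y <= 1 ->
  0 <= m -> 1 - 4 * d <= l <= mu -> l * m = d * mu * (1 - y) ^+ 2 ->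
  ent m <= - (m * ln d) + 31 / 14 * (d * (y * (1 - y))).
Proof.
move=> /andP[d0 d1] /andP[y0 y1] m0 /andP[sl lmu] P.
have mu0 : 0 < mu by rewrite /mu; lra.
have lp : 0 < l by lra.
have [->|mN0] := eqVneq m 0.
  by rewrite ent0 mul0r oppr0 add0r !mulr_ge0//; lra.
have mp : 0 < m by rewrite lt_def mN0.
have zp : 0 < 1 - y.
  rewrite lt_def subr_ge0 y1 andbT; apply/eqP => zE.
  by have := mulr_gt0 lp mp; rewrite P zE expr0n mulr0 ltxx.
have mE : m = d * mu * (1 - y) ^+ 2 / l by rewrite -P; field; lra.
have lnm : ln m = ln d + ln mu + 2 * ln (1 - y) - ln l.
  rewrite mE ln_div ?posrE ?mulr_gt0 ?exprn_gt0// lnM ?posrE ?mulr_gt0 ?exprn_gt0//.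
  by rewrite lnM ?posrE// lnXn//; lra.
have zl := ln_ge_sub1V zp.
have lnl : ln l <= ln mu by rewrite ler_ln ?posrE.
have mz : m / (1 - y) <= d * (1 - y) * (31 / 28).
  rewrite ler_pdivrMr// mE ler_pdivrMr//.
  rewrite -subr_ge0 (_ : _ - _ = d * (1 - y) ^+ 2 * (31 / 28 * l - mu)); last by ring.
  apply: mulr_ge0; first by rewrite mulr_ge0 ?sqr_ge0 ?(ltW d0).
  by rewrite /mu; lra.
have e1 : m / (1 - y) * y = m * ((1 - y)^-1 - 1) by field; lra.
have := ler_wpM2r y0 mz; rewrite e1 => H.
have : m * (ln d + 2 * (1 - (1 - y)^-1)) <= m * ln m by rewrite ler_wpM2l// lnm; lra.
by rewrite /ent; move: H; clear; lra.
Qed.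

(** From [d <= 3/40] and [mu - m >= 1 - 4 d >= 7/10] comes [mu - l <= 3/28 mu y^2], and
    [3/28 * 7/25 = 3/100] is the loss left by [97/100]. *)
Lemma small_root_gap d y l m (mu := 1 - 3 * d) : 0 < d <= 3 / 40 -> 0 <= y <= 1 ->
  m <= d -> 1 - 4 * d <= l <= mu -> l * m = d * mu * (1 - y) ^+ 2 ->
  (mu - l) * (mu - m) = d * mu * y ^+ 2 ->
  97 / 100 * (d * (y * (1 - y))) <= d * (1 - y) - m.
Proof.
move=> /andP[d0 d1] /andP[y0 y1] md /andP[sl lmu] P E.
have mu0 : 0 < mu by rewrite /mu; lra.
have lp : 0 < l by lra.
have dz : 0 <= d * (1 - y) by rewrite mulr_ge0 ?subr_ge0 ?(ltW d0).
suff : m <= d * (1 - y) * (1 - 97 / 100 * y) by clear; lra.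
rewrite (_ : m = d * mu * (1 - y) ^+ 2 / l); last by rewrite -P; field; lra.
rewrite ler_pdivrMr//.
rewrite -subr_ge0 (_ : _ - _ =
    d * (1 - y) * (3 / 100 * mu * y - (mu - l) * (1 - 97 / 100 * y))); last by field.
apply: mulr_ge0 => //.
have muy : 0 <= mu * y ^+ 2 by rewrite mulr_ge0 ?sqr_ge0 ?ltW.
have dl : mu - l <= 3 / 28 * mu * y ^+ 2.
  have : (mu - l) * (7 / 10) <= d * mu * y ^+ 2.
    by rewrite -E; apply: ler_wpM2l; rewrite ?subr_ge0//; move: md; rewrite /mu; lra.
  have := ler_wpM2r muy d1.
  by clear; lra.
have y97 : 0 <= 1 - 97 / 100 * y by lra.
have := ler_wpM2r y97 dl.
have yb : y * (1 - 97 / 100 * y) <= 7 / 25.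
  have := sqr_ge0 (y - 1 / 2); have : y ^+ 2 <= 1 by rewrite expr_le1.
  by clear; lra.
have : 0 <= mu * y * (3 / 100 - 3 / 28 * (y * (1 - 97 / 100 * y))).
  by apply: mulr_ge0; [apply: mulr_ge0 => //; exact: ltW|lra].
by clear; lra.
Qed.

(** A reverse Jensen inequality: [kap] is the mean of [1 - 3 d] and [1 - 4 d] with weights [1 - y]
    and [y]. The error is variance over mean, [d^2 y (1 - y) / kap], with [d / kap <= 3/28]. *)
Lemma chord_ent_ge d y (kap := 1 - 4 * d + d * (1 - y)) : 0 < d <= 3 / 40 -> 0 <= y <= 1 ->
  - (kap * ln kap) - 3 / 28 * (d * (y * (1 - y))) <=
  (1 - y) * ent (1 - 3 * d) + y * ent (1 - 4 * d).
Proof.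
move=> /andP[d0 d1] /andP[y0 y1].
have dz : 0 <= d * (1 - y) by rewrite mulr_ge0 ?subr_ge0 ?(ltW d0).
have kap0 : 0 < kap by rewrite /kap; lra.
have tangent t : 0 < t -> t * ln t <= t * ln kap + t * (t / kap - 1).
  move=> t0; have q : 0 < t / kap by rewrite divr_gt0.
  have := ln_le_subr1 q; rewrite ln_div ?posrE// => /(ler_wpM2l (ltW t0)).
  by clear; lra.
have z0 : 0 <= 1 - y by lra.
have := ler_wpM2l z0 (tangent (1 - 3 * d) ltac:(lra)).
have := ler_wpM2l y0 (tangent (1 - 4 * d) ltac:(lra)).
have e1 : (1 - y) * ((1 - 3 * d) * ln kap) + y * ((1 - 4 * d) * ln kap) = kap * ln kap.
  by rewrite /kap; ring.
have e2 : (1 - y) * ((1 - 3 * d) * ((1 - 3 * d) / kap - 1)) + y * ((1 - 4 * d) * ((1 - 4 * d) / kap - 1))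
    = d * (y * (1 - y)) * (d / kap).
  by rewrite /kap; field; rewrite -/kap; lra.
have e3 : d * (y * (1 - y)) * (d / kap) <= d * (y * (1 - y)) * (3 / 28).
  apply: ler_wpM2l; first by rewrite !mulr_ge0 ?(ltW d0).
  by rewrite ler_pdivrMr// /kap; lra.
by rewrite /ent; move: e1 e2 e3; clear; lra.
Qed.

(** At the worst point [d = 3/40] the ratio [(1 - 4 d) / d] is [28/3 = 2^3 * 7/6], and
    [3 * 48/70 + 2/13 + 1 > 32/10]. *)
Lemma ln_ratio_ge d y : 0 < d <= 3 / 40 -> 0 <= y <= 1 ->
  32 / 10 <= - ln d + 1 + ln (1 - 4 * d + d * (1 - y)).
Proof.
move=> /andP[d0 d1] /andP[y0 y1].
have dz : 0 <= d * (1 - y) by rewrite mulr_ge0 ?subr_ge0 ?(ltW d0).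
have sp : 0 < 1 - 4 * d by lra.
have [a b] := @ln2_bounds R.
have := @ln_ge_pade R (7 / 6) ltac:(lra).
rewrite (_ : 2 * (7 / 6 - 1) / (7 / 6 + 1) = 2 / 13 :> R); last by field; lra.
have : ln (28 / 3) <= ln ((1 - 4 * d) / d).
  by rewrite ler_ln ?posrE ?divr_gt0// ler_pdivlMr//; lra.
rewrite [ln ((1 - 4 * d) / d)]ln_div ?posrE//.
have -> : 28 / 3 = 2 ^+ 3 * (7 / 6) :> R by field.
have p76 : 0 < 7 / 6 :> R by lra.
have p8 : 0 < 2 ^+ 3 :> R by rewrite exprn_gt0.
have : ln (1 - 4 * d) <= ln (1 - 4 * d + d * (1 - y)).
  by rewrite ler_ln ?posrE//; lra.
by rewrite lnM ?posrE// lnXn//; move: a; clear; lra.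
Qed.

(** With [l = kap + (d (1 - y) - m)], the main terms agree with the chord. In units of
    [d y (1 - y)], the losses [2 * 39/100] from [kfun], [31/14] from [m] and [3/28] from the chord
    stay below the gain [97/100 * 32/10]. *)
Lemma entropy_le_chord_outer s p l m : 0 < s <= 3 / 10 -> 0 <= p <= 1 ->
  0 <= m -> m <= l -> l + m = 1 - s * (1 + p ^+ 2) / 2 ->
  l * m = s / 4 * (1 - 3 / 4 * s) * (1 - p ^+ 2) ^+ 2 ->
  ent (s * ((1 + p) ^+ 2 / 4)) + ent (s * ((1 - p) ^+ 2 / 4)) + ent l + ent m <=
  (1 - p ^+ 2) * entH4 s + p ^+ 2 * entH2 s.
Proof.
move=> s03 p01 m0 ml S P; have /andP[s0 s1] := s03.
have K := kfun_ge_chord p01.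
rewrite (ent_outer_pair s0 p01).
set y := p ^+ 2 in K S P *; set k := kfun p in K *.
have y01 : 0 <= y <= 1.
  by case/andP: p01 => p0 p1; rewrite /y sqr_ge0 expr_le1.
have /andP[y0 y1] := y01.
have s45 : 0 < s <= 4 / 5 by lra.
have [md sl lmu E] := root_location s45 y01 erefl m0 ml S P.
pose d := s / 4.
have sd : s = 4 * d by rewrite /d; field.
have mud : 1 - 3 / 4 * s = 1 - 3 * d by rewrite sd; field.
rewrite /entH4 /entH2; rewrite -/d in md P E *.
rewrite mud in P E lmu *; rewrite sd in s0 s1 sl S *; clearbody d; clear s sd s03 s45 mud.
have d01 : 0 < d <= 3 / 40 by lra.
have /andP[d0 d1] := d01.
have l01 : 1 - 4 * d <= l <= 1 - 3 * d by rewrite sl.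
have hm := small_root_ent_le d01 y01 m0 l01 P.
have he := small_root_gap d01 y01 md l01 P E.
have hc := chord_ent_ge d01 y01.
have hL := ln_ratio_ge d01 y01.
set kap := 1 - 4 * d + d * (1 - y) in hc hL.
have dyz : 0 <= d * (y * (1 - y)) by rewrite !mulr_ge0//; lra.
have dz : 0 <= d * (1 - y) by rewrite mulr_ge0 ?subr_ge0 ?(ltW d0).
have kap0 : 0 < kap by rewrite /kap; lra.
have hl := @ent_le_tangent R l kap ltac:(lra) kap0.
have X : 97 / 100 * (d * (y * (1 - y))) * (32 / 10) <=
    (d * (1 - y) - m) * (- ln d + 1 + ln kap).
  by apply: ler_pM => //; move: dyz; clear; lra.
have hs : ent (4 * d) = - (4 * d) * (ln d + 2 * ln 2).
  rewrite /ent lnM ?posrE// (_ : ln 4 = 2 * ln 2); first by ring.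
  by rewrite (_ : 4 = 2 ^+ 2 :> R); [rewrite lnXn//; ring|ring].
have K2 := ler_wpM2l (ltW d0) K.
have lE : l = kap + (d * (1 - y) - m) by rewrite /kap; move: S; clear; lra.
have e6 : l * ln kap = kap * ln kap + (d * (1 - y) - m) * ln kap by rewrite {1}lE; ring.
rewrite hs (_ : ent d = - (d * ln d))//.
move: hm hc hl X K2 dyz lE; rewrite e6; clearbody kap.
by clear; lra.
Qed.

End Outer.

(** * Maximum over the eigenvalue parameters and the crossing of H2 and H4 *)

Section Bound.
Context {R : realType}.
Implicit Types x y z s t u v l m p : R.

(** The constraint on [4 (u v)] is the arithmetic-geometric mean inequality for [a_0 b_0] and
    [a_1 b_1], whose sum is [1 - (u + v)]. *)
Lemma entropy_le_max s u v l m : 0 < s <= 1 -> 0 <= u -> 0 <= v -> u + v <= 1 ->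
  4 * (u * v) <= (1 - (u + v)) ^+ 2 -> 0 <= l -> 0 <= m ->
  l + m = 1 - s * (u + v) -> l * m = s * (4 - 3 * s) * (u * v) ->
  ent (s * u) + ent (s * v) + ent l + ent m <= Num.max (entH2 s) (entH4 s).
Proof.
move=> s01 u0 v0; wlog ml : l m / m <= l => [H uv1 uv l0 m0 S P|uv1 uv l0 m0 S P].
  have [ml|/ltW lm] := leP m l; first exact: H.
  by rewrite addrAC; apply: H => //; [rewrite addrC|rewrite mulrC].
have /andP[s0 s1] := s01.
rewrite le_max.
have [t12|t12] := leP (u + v) (1 / 2).
  apply/orP; right; apply: entropy_le_H4_inner => //.
  have := sqr_ge0 (u - v); nra.
set t := u + v in uv1 uv S t12.
(* With this [p], the pair [(1 +- p)^2 / 4] has sum [t] and the extremal product [(1 - t)^2 / 4];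
   [l'] and [m'] below are the eigenvalues belonging to it. *)
pose y := 2 * t - 1; pose p := Num.sqrt y.
have y01 : 0 <= y <= 1 by rewrite /y; lra.
have py : p ^+ 2 = y by rewrite sqr_sqrtr; lra.
have p01 : 0 <= p <= 1.
  by rewrite sqrtr_ge0 -sqrtr1 ler_wsqrtr; lra.
pose T := 1 - s * t; pose D := s / 4 * (1 - 3 / 4 * s) * (1 - p ^+ 2) ^+ 2.
have D0 : 0 <= D by rewrite /D !mulr_ge0 ?sqr_ge0//; lra.
have T0 : 0 <= T by rewrite /T; nra.
pose q := Num.sqrt (T ^+ 2 - 4 * D).
have qq : q ^+ 2 = T ^+ 2 - 4 * D.
  apply: sqr_sqrtr; rewrite /T /D py.
  have -> : t = (1 + y) / 2 by rewrite /y; field.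
  rewrite [X in 0 <= X](_ : _ = (1 - s) * ((1 - s) + s * (1 - y) * y)); last by field.
  by apply: mulr_ge0; [lra|apply: addr_ge0; [lra|apply: mulr_ge0; [apply: mulr_ge0|]; lra]].
have q0 : 0 <= q by exact: sqrtr_ge0.
pose l' := (T + q) / 2; pose m' := (T - q) / 2.
have S' : l' + m' = 1 - s * (1 + p ^+ 2) / 2 by rewrite /l' /m' /T py /y; field.
have P' : l' * m' = D.
  rewrite (_ : l' * m' = (T ^+ 2 - q ^+ 2) / 4); last by rewrite /l' /m'; field.
  by rewrite qq; field.
have ml' : m' <= l' by rewrite /l' /m'; lra.
have m'0 : 0 <= m' by rewrite /m'; nra.
have l'0 : 0 <= l' by lra.
have B : ent l + ent m <= ent l' + ent m'.
  apply: ent_two_point => //; first by rewrite S' py /y S; field.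
  rewrite P P' /D py (_ : 1 - y = 2 * (1 - t)); last by rewrite /y; ring.
  rewrite -subr_ge0 (_ : _ - _ = s * (1 - 3 / 4 * s) * ((1 - t) ^+ 2 - 4 * (u * v))); last by field.
  by rewrite mulr_ge0 ?subr_ge0// mulr_ge0; lra.
have A : ent (s * u) + ent (s * v) <= ent (s * ((1 + p) ^+ 2 / 4)) + ent (s * ((1 - p) ^+ 2 / 4)).
  have sq0 c : 0 <= s * (c ^+ 2 / 4).
    by rewrite mulr_ge0 ?(ltW s0)// divr_ge0 ?sqr_ge0.
  apply: ent_two_point => //; try by rewrite mulr_ge0 ?(ltW s0).
    rewrite (_ : _ + s * ((1 - p) ^+ 2 / 4) = s * ((1 + p ^+ 2) / 2)); last by field.
    by rewrite py /y /t; field.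
  rewrite (_ : _ * (s * ((1 - p) ^+ 2 / 4)) = s ^+ 2 * ((1 - p ^+ 2) ^+ 2 / 16)); last by field.
  rewrite py (_ : 1 - y = 2 * (1 - t)); last by rewrite /y; ring.
  rewrite -subr_ge0 (_ : _ - _ = s ^+ 2 / 4 * ((1 - t) ^+ 2 - 4 * (u * v))); last by field.
  by rewrite mulr_ge0 ?subr_ge0// divr_ge0 ?sqr_ge0.
have [s3|s3] := leP (3 / 10) s.
  have s31 : 3 / 10 <= s <= 1 by rewrite s3.
  have := entropy_le_H4_outer s31 p01 m'0 ml' S' P' => C.
  by apply/orP; right; lra.
have s31 : 0 < s <= 3 / 10 by rewrite s0 ltW.
have := entropy_le_chord_outer s31 p01 m'0 ml' S' P'; rewrite py => C.
have [h|/ltW h] := leP (entH2 s) (entH4 s); apply/orP; [right|left].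
  have : y * entH2 s <= y * entH4 s by rewrite ler_wpM2l//; lra.
  lra.
have : (1 - y) * entH4 s <= (1 - y) * entH2 s by rewrite ler_wpM2l//; lra.
lra.
Qed.

(** The quotient has derivative [(ln (1 - 3 s / 4) - ln (1 - s)) / s^2]. The division matters:
    [entH4 - entH2] itself vanishes at 0 and is not monotone. *)
Lemma entH_slope_homo s s' : 0 < s -> s <= s' -> s' < 1 ->
  (entH4 s - entH2 s) / s <= (entH4 s' - entH2 s') / s'.
Proof.
move=> s0 ss s1.
pose f t : R := ln t / 4 + t^-1 * ((1 - t) * ln (1 - t) - (1 - 3 / 4 * t) * ln (1 - 3 / 4 * t)).
have E t : 0 < t < 1 -> (entH4 t - entH2 t) / t = f t + 3 / 2 * ln 2.
  move=> /andP[t0 t1]; rewrite /entH4 /entH2 /ent.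
  have -> : ln (t / 4) = ln t - 2 * ln 2.
    by rewrite ln_div ?posrE// (_ : 4 = 2 ^+ 2 :> R); [rewrite lnXn//; lra|ring].
  by rewrite /f; field; lra.
rewrite !E; try lra.
rewrite lerD2r.
apply: (@ler_is_derive R f (fun t => (ln (1 - 3 / 4 * t) - ln (1 - t)) * t ^- 2)) => // t /andP[t1 t2].
  have t0 : 0 < t by lra.
  have tN0 : t != 0 by lra.
  have ? := is_derive1_ln t0.
  have ? : is_derive t 1 (fun t => t^-1 : R) (- t ^- 2 *: (1 : R)).
    exact: is_deriveV.
  have dlin (c : R) : 0 < 1 - c * t ->
      is_derive t 1 (fun t => ln (1 - c * t) : R) ((1 - c * t)^-1 * - c).
    move=> ct; apply: (@is_derive1_comp R (@ln R) (fun t => 1 - c * t)).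
      exact: is_derive1_ln.
    by apply: is_derive_eq; rewrite /GRing.scale/=; lra.
  have d1 : is_derive t 1 (fun t => ln (1 - t) : R) ((1 - t)^-1 * -1).
    by have := @dlin 1; under [fun t => _]eq_fun do rewrite mul1r; rewrite mul1r; apply; lra.
  have d2 := @dlin (3 / 4) ltac:(lra).
  rewrite /f. apply: is_derive_eq.
  rewrite /GRing.scale /=. field. lra.
rewrite mulr_ge0 ?invr_ge0 ?sqr_ge0// subr_ge0 ler_ln ?posrE; lra.
Qed.

Lemma entH_lt_one : entH2 1 < entH4 (1 : R).
Proof.
rewrite /entH2 /entH4 subrr ent0.
have -> : 1 - 3 / 4 * 1 = 1 / 4 :> R by field.
rewrite /ent ln1 mulr0 oppr0 addr0.
have : ln (1 / 4) < 0 :> R by apply: ln_lt0; lra.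
lra.
Qed.

Lemma entH_crossing s0 s : 0 < s0 <= 1 -> entH2 s0 = entH4 s0 -> 0 < s <= 1 ->
  (s <= s0 -> entH4 s <= entH2 s) /\ (s0 <= s -> entH2 s <= entH4 s).
Proof.
move=> /andP[s00 s01] E /andP[sp s1].
(* The slope comparison excludes 1, so a crossing at 1 is ruled out by the strict inequality
   there. *)
have s0lt : s0 < 1.
  rewrite lt_def s01 andbT; apply/eqP => e; have := entH_lt_one; rewrite e E; lra.
split=> ss.
  have := entH_slope_homo sp ss s0lt; rewrite E subrr mul0r.
  by rewrite pmulr_lle0 ?invr_gt0// subr_le0.
have [->|sN1] := eqVneq s 1; first exact/ltW/entH_lt_one.
have slt : s < 1 by rewrite lt_def eq_sym sN1.
have := entH_slope_homo s00 ss slt; rewrite E subrr mul0r.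
by rewrite pmulr_lge0 ?invr_gt0// subr_ge0.
Qed.

End Bound.

(** * Pinching *)

Local Open Scope complex_scope.

Section Adjoint.
Local Open Scope sesquilinear_scope.
Context {R : realType}.
Local Notation C := R[i].

Definition nsq (c : C) : R := complex.Re c ^+ 2 + complex.Im c ^+ 2.

Lemma mulc_conj (c : C) : c * conjc c = (nsq c)%:C.
Proof. by case: c => a b; rewrite /nsq; simpc; rewrite !expr2 (mulrC b a) addNr. Qed.

Lemma conjcM (u v : C) : conjc (u * v) = conjc u * conjc v.
Proof. exact: rmorphM. Qed.

Lemma nsq_ge0 c : 0 <= nsq c. Proof. by rewrite addr_ge0 ?sqr_ge0. Qed.

Lemma adjmxE m n (A : 'M[C]_(m, n)) i j : adjmx A i j = conjc (A j i).
Proof. by rewrite !mxE. Qed.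

Lemma adjmxK m n (A : 'M[C]_(m, n)) : adjmx (adjmx A) = A.
Proof. by apply/matrixP => i j; rewrite !adjmxE conjcK. Qed.

Lemma adjmxM m n p (A : 'M[C]_(m, n)) (B : 'M[C]_(n, p)) :
  adjmx (A *m B) = adjmx B *m adjmx A.
Proof. by rewrite /adjmx map_mxM trmx_mul. Qed.

Lemma adjmx1 n : adjmx (1%:M : 'M[C]_n) = 1%:M.
Proof. by rewrite /adjmx map_mx1 trmx1. Qed.

Lemma mulmx_adj_diag m n (A : 'M[C]_(m, n)) i :
  (A *m adjmx A) i i = (\sum_j nsq (A i j))%:C.
Proof.
by rewrite mxE rmorph_sum; apply: eq_bigr => j _; rewrite adjmxE mulc_conj.
Qed.

Lemma mulmx_diag_adj m n (A : 'M[C]_(m, n)) (lam : 'rV[R]_n) i :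
  (A *m diag_mx (map_mx (fun t : R => t%:C) lam) *m adjmx A) i i =
  (\sum_j nsq (A i j) * lam 0 j)%:C.
Proof.
rewrite mxE rmorph_sum; apply: eq_bigr => j _.
by rewrite mul_mx_diag !mxE rmorphM /= -mulc_conj mulrAC.
Qed.

(** [G = A A^*] is an orthogonal projection, so a diagonal entry [g] is the squared norm of its row
    and satisfies [g^2 <= g]. *)
Lemma partial_isometry_row m n (A : 'M[C]_(m, n)) i :
  A *m adjmx A *m A = A -> \sum_j nsq (A i j) <= 1.
Proof.
move=> AE; set g := \sum_j _.
pose G := A *m adjmx A.
have Gi : G i i = g%:C by exact: mulmx_adj_diag.
have GG : G *m adjmx G = G by rewrite /G adjmxM adjmxK mulmxA AE.
have : g = \sum_j nsq (G i j).
  by apply: (@complexI R); rewrite -Gi -[in LHS]GG mulmx_adj_diag.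
rewrite (bigD1 i)//= Gi /nsq /= expr0n addr0 => gE.
have : g ^+ 2 <= g by rewrite [leRHS]gE lerDl sumr_ge0// => j _; exact: nsq_ge0.
have : 0 <= g by apply: sumr_ge0 => j _; exact: nsq_ge0.
nra.
Qed.

Lemma shannonE (s : seq R) : shannon s * ln 2 = \sum_(p <- s) ent p.
Proof.
have ln2 : ln 2 != 0 :> R by rewrite gt_eqF// ln_gt0// ltr1n.
rewrite /shannon mulNr mulr_suml -sumrN; apply: eq_bigr => p _.
rewrite /xlog2x /ent /log2; case: eqP => [->|_]; first by rewrite !mul0r.
by congr (- _); field.
Qed.

Lemma shannon_enum n (lam : 'rV[R]_n) :
  shannon [seq lam 0 i | i <- enum 'I_n] * ln 2 = \sum_i ent (lam 0 i).
Proof. by rewrite shannonE big_map enumT. Qed.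

(** The squared moduli of [W = E V] form a doubly substochastic matrix sending the spectrum [lam] to
    the diagonal [r]. Jensen applies row by row, and no entropy is lost because columns with nonzero
    eigenvalue have full mass. *)
Lemma entropy_le_pinched k N p (E : 'M[C]_(k, N)) (B : 'M[C]_(N, p)) (r : 'I_k -> R) e :
  E *m adjmx E *m E = E -> adjmx E *m E *m B = B ->
  (forall i, (E *m B *m adjmx (E *m B)) i i = (r i)%:C) ->
  vn_entropy_is (B *m adjmx B) e -> e * ln 2 <= \sum_i ent (r i).
Proof.
move=> EE EB Er [V [lam [VV [rhoE ->]]]]; rewrite shannon_enum.
have VV' : adjmx V *m V = 1%:M by exact: mulmx1C.
have lam0 j : 0 <= lam 0 j.
  have : (adjmx V *m B *m adjmx (adjmx V *m B)) j j = (lam 0 j)%:C.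
    rewrite adjmxM adjmxK mulmxA -(mulmxA (adjmx V)) rhoE !mulmxA VV' mul1mx.
    by rewrite -mulmxA VV' mulmx1 !mxE eqxx mulr1n.
  by rewrite mulmx_adj_diag => /complexI <-; apply: sumr_ge0 => ? _; exact: nsq_ge0.
have lam1 : \sum_j lam 0 j = \sum_i r i.
  apply: (@complexI R); rewrite !rmorph_sum; transitivity (\tr (B *m adjmx B)).
    rewrite rhoE mxtrace_mulC mulmxA VV' mul1mx.
    by apply: eq_bigr => j _; rewrite !mxE eqxx mulr1n.
  have -> : B *m adjmx B = adjmx E *m (E *m B *m adjmx B) by rewrite !mulmxA EB.
  rewrite mxtrace_mulC -[X in \tr X]mulmxA -adjmxM.
  by apply: eq_bigr => i _; exact: Er.
pose W := E *m V.
have WW : W *m adjmx W *m W = W.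
  rewrite /W adjmxM !mulmxA -(mulmxA E V) VV mulmx1.
  by rewrite EE.
have row i : \sum_j nsq (W i j) <= 1 by exact: partial_isometry_row.
have col j : \sum_i nsq (W i j) <= 1.
  have : adjmx W *m adjmx (adjmx W) *m adjmx W = adjmx W.
    by rewrite -[RHS](congr1 adjmx WW) (adjmxM (W *m adjmx W)) (adjmxM W) !adjmxK mulmxA.
  move=> /(@partial_isometry_row _ _ _ j); apply: le_trans.
  by apply: ler_sum => i _; rewrite adjmxE /nsq; case: (W i j) => a b /=; rewrite sqrrN.
have rE i : r i = \sum_j nsq (W i j) * lam 0 j.
  apply: (@complexI R); rewrite -Er -mulmx_diag_adj /W !adjmxM !mulmxA.
  by rewrite -[E *m B *m _]mulmxA rhoE !mulmxA.
(* Equality of the traces makes a sum of nonnegative terms vanish, hence each of them. *)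
have colE j : lam 0 j * (1 - \sum_i nsq (W i j)) = 0.
  have : \sum_j lam 0 j * (1 - \sum_i nsq (W i j)) = 0.
    under eq_bigr do rewrite mulrBr mulr1.
    rewrite sumrB lam1; under eq_bigr do rewrite rE.
    rewrite exchange_big /= -sumrB big1// => i _.
    by rewrite mulr_sumr -sumrB big1// => ? _; rewrite mulrC subrr.
  move/eqP; rewrite psumr_eq0 => [/allP/(_ j)|i _]; last first.
    by rewrite mulr_ge0// subr_ge0.
  by rewrite mem_index_enum => /(_ isT)/implyP/(_ isT)/eqP.
have -> : \sum_j ent (lam 0 j) = \sum_i \sum_j nsq (W i j) * ent (lam 0 j).
  rewrite exchange_big; apply: eq_bigr => j _; rewrite -mulr_suml.
  apply/eqP; rewrite -subr_eq0 -[X in X - _]mul1r -mulrBl /ent mulrN mulrA (mulrC (1 - _)).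
  by rewrite colE mul0r oppr0.
by apply: ler_sum => i _; rewrite rE; apply: ent_jensen => // j; exact: nsq_ge0.
Qed.

Lemma gram_diagonalize k p (B : 'M[C]_(k, p)) :
  exists2 X : 'M[C]_k, X *m adjmx X = 1%:M &
    X *m B *m adjmx (X *m B) =
    diag_mx (\row_i (\sum_t nsq ((X *m B) i t))%:C).
Proof.
pose A := B *m adjmx B.
have AA : adjmx A = A by rewrite adjmxM adjmxK.
have adjE m n (D : 'M[C]_(m, n)) : D ^t* = adjmx D.
  by apply/matrixP => i j; rewrite !mxE.
have /orthomx_spectralP : A \is normalmx by apply/normalmxP; rewrite adjE AA.
have /unitarymxP := spectral_unitarymx A.
rewrite invmx_unitary ?spectral_unitarymx// !adjE.
set P := spectralmx A; set sp := spectral_diag A => PP AE.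
exists P => //.
have E : P *m B *m adjmx (P *m B) = diag_mx sp.
  rewrite adjmxM mulmxA -(mulmxA P) -/A AE !mulmxA PP mul1mx.
  by rewrite -mulmxA PP mulmx1.
rewrite E; congr diag_mx; apply/rowP => i; rewrite !mxE -mulmx_adj_diag E.
by rewrite mxE eqxx mulr1n.
Qed.

End Adjoint.

(** * Partial swap *)

Section PartialSwap.
Context {R : realType}.
Local Notation C := R[i].

Lemma sum_mxvec_index (V : nmodType) m n (F : 'I_(m * n) -> V) :
  \sum_i F i = \sum_a \sum_b F (mxvec_index a b).
Proof.
rewrite (reindex _ (curry_mxvec_bij _ _)) /= pair_bigA /=.
by apply: eq_bigr => -[].
Qed.

(** Operators between tensor products, with pairs encoded by [mxvec_index] as in [rhoB]. *)
Definition idxmx m n p q (f : 'I_m -> 'I_n -> 'I_p -> 'I_q -> C) : 'M[C]_(m * n, p * q) :=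
  \matrix_(i, j) mxvec (\matrix_(a, b) mxvec (\matrix_(a', b') f a b a' b') 0 j) 0 i.

Lemma idxmxE m n p q (f : 'I_m -> 'I_n -> 'I_p -> 'I_q -> C) a b a' b' :
  idxmx f (mxvec_index a b) (mxvec_index a' b') = f a b a' b'.
Proof. by rewrite mxE mxvecE mxE mxvecE mxE. Qed.

Lemma idxmxP m n p q (A B : 'M[C]_(m * n, p * q)) :
  (forall a b a' b', A (mxvec_index a b) (mxvec_index a' b') =
                     B (mxvec_index a b) (mxvec_index a' b')) -> A = B.
Proof.
move=> AB; apply/matrixP => i j.
by case/mxvec_indexP: i => a b; case/mxvec_indexP: j => a' b'.
Qed.

Lemma mxvec_index_eq m n (a a' : 'I_m) (b b' : 'I_n) :
  (mxvec_index a b == mxvec_index a' b') = (a == a') && (b == b').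
Proof.
rewrite /mxvec_index (inj_eq (@cast_ord_inj _ _ _)) (inj_eq enum_rank_inj).
by [].
Qed.

Lemma scalar_mxvec_index m n (a a' : 'I_m) (b b' : 'I_n) :
  (1%:M : 'M[C]_(m * n)) (mxvec_index a b) (mxvec_index a' b') =
  ((a == a') && (b == b'))%:R.
Proof. by rewrite mxE mxvec_index_eq. Qed.

Definition kron m n p q (A : 'M[C]_(m, p)) (B : 'M[C]_(n, q)) : 'M[C]_(m * n, p * q) :=
  idxmx (fun a b a' b' => A a a' * B b b').

Lemma kron_mul m n p q k l (A : 'M[C]_(m, p)) (B : 'M[C]_(n, q)) (A' : 'M[C]_(p, k)) (B' : 'M[C]_(q, l)) :
  kron A B *m kron A' B' = kron (A *m A') (B *m B').
Proof.
apply: idxmxP => a b a' b'; rewrite idxmxE mxE sum_mxvec_index !mxE mulr_suml.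
apply: eq_bigr => i _; rewrite mulr_sumr; apply: eq_bigr => j _.
by rewrite !idxmxE; ring.
Qed.

Lemma kron_adj m n p q (A : 'M[C]_(m, p)) (B : 'M[C]_(n, q)) :
  adjmx (kron A B) = kron (adjmx A) (adjmx B).
Proof. by apply: idxmxP => a b a' b'; rewrite adjmxE !idxmxE !adjmxE rmorphM. Qed.

Lemma kron1 m n : kron 1%:M 1%:M = 1%:M :> 'M[C]_(m * n).
Proof.
by apply: idxmxP => a b a' b'; rewrite idxmxE scalar_mxvec_index !mxE -natrM mulnb.
Qed.

(* The amplitudes of [(c + i s SWAP) (phi (x) psi)], with rows indexed by B R_B
   and columns by A R_A. *)
Definition pswap m n (c s : R) (phi : 'M[C]_(2, m)) (psi : 'M[C]_(2, n)) : 'M[C]_(2 * n, 2 * m) :=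
  idxmx (fun b t a r => c%:C * (phi a r * psi b t) + 'i * s%:C * (phi b r * psi a t)).

(** SWAP commutes with [A (x) A], so acting by [A] on both qubits amounts to acting on the inputs.
    The factor on the A side is transposed because A R_A indexes columns. *)
Lemma kron_pswap m n q c s (phi : 'M[C]_(2, m)) (psi : 'M[C]_(2, n)) (A : 'M[C]_2) (Z : 'M[C]_(q, n)) :
  kron A Z *m pswap c s phi psi *m kron A^T 1%:M =
  pswap c s (A *m phi) (A *m psi *m Z^T).
Proof.
apply: idxmxP => k l a' r; rewrite idxmxE mxE sum_mxvec_index.
transitivity (\sum_a A a' a * (kron A Z *m pswap c s phi psi) (mxvec_index k l) (mxvec_index a r)).
  apply: eq_bigr => a _; rewrite (bigD1 r)//= big1 => [|r' rr']; last first.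
    by rewrite idxmxE [1%:M _ _]mxE (negPf rr') mulr0 mulr0.
  by rewrite addr0 idxmxE [1%:M _ _]mxE eqxx mulr1 [A^T _ _]mxE mulrC.
have H (a : 'I_2) : (kron A Z *m pswap c s phi psi) (mxvec_index k l) (mxvec_index a r) =
   c%:C * (phi a r * (A *m psi *m Z^T) k l) + 'i * s%:C * ((A *m phi) k r * (psi *m Z^T) a l).
  rewrite mxE sum_mxvec_index.
  under eq_bigr => b _ do under eq_bigr => t _ do rewrite !idxmxE.
  rewrite -mulmxA [(A *m (psi *m Z^T)) k l]mxE [(A *m phi) k r]mxE.
  rewrite mulr_sumr mulr_suml !mulr_sumr -big_split /=; apply: eq_bigr => b _.
  rewrite !mxE !mulr_sumr -big_split /=; apply: eq_bigr => t _.
  by rewrite !mxE; ring.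
under eq_bigr do rewrite H mulrDr.
rewrite big_split /= [(A *m phi) a' r]mxE -[A *m psi *m Z^T]mulmxA [(A *m (psi *m Z^T)) a' l]mxE.
congr (_ + _); first by rewrite mulr_suml mulr_sumr; apply: eq_bigr => a _; ring.
by rewrite !mulr_sumr; apply: eq_bigr => a _; ring.
Qed.

Lemma ord2E (i : 'I_2) : i = ord0 \/ i = lift ord0 ord0.
Proof. by case: i => [[|[|//]] hi]; [left|right]; apply: val_inj. Qed.

Lemma ord_max2 : ord_max = lift ord0 ord0 :> 'I_2.
Proof. exact: val_inj. Qed.

Lemma sum_pauli (a b a' b' : 'I_2) :
  \sum_(j < 3) (pauli j a a' * pauli j b b') =
  2 * ((a == b') && (b == a'))%:R - ((a == a') && (b == b'))%:R :> C.
Proof.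
rewrite !big_ord_recl big_ord0 /pauli /= /sigma1 /sigma2 /sigma3 !mxE.
have ii : 'i * 'i = -1 :> C by rewrite -expr2 sqr_i.
by case: (ord2E a) => ->; case: (ord2E b) => ->; case: (ord2E a') => ->; case: (ord2E b') => -> /=;
  rewrite ?mulrNN ?mulrN ?mulNr ?ii; ring.
Qed.

Lemma Uop_swap (x : R) (a b a' b' : 'I_2) :
  Uop x a b a' b' = (cos x -i* sin x) *
    ((cos (2 * x))%:C * ((a == a') && (b == b'))%:R +
     'i * (sin (2 * x))%:C * ((a == b') && (b == a'))%:R).
Proof.
rewrite /Uop sum_pauli.
have -> : (1%:M : 'M[C]_2) a a' * (1%:M : 'M[C]_2) b b' = ((a == a') && (b == b'))%:R.
  by rewrite !mxE -natrM mulnb.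
have c2 := cos2Dsin2 x.
(* This is [cos^3 x + i sin^3 x = e^(-ix) (cos 2x + i sin x cos x)]; the second term cancels the
   identity part of [2 SWAP - 1]. *)
have e1 : cos x ^+ 3 +i* sin x ^+ 3 =
   (cos x -i* sin x) * (cos (2 * x))%:C + 'i * (sin x * cos x)%:C * (cos x -i* sin x).
  have h1 : cos x * (cos x ^+ 2 + sin x ^+ 2) = cos x by rewrite c2 mulr1.
  have h2 : sin x * (cos x ^+ 2 + sin x ^+ 2) = sin x by rewrite c2 mulr1.
  rewrite mulr_natl cos_mulr2n; simpc; congr (_ +i* _); lra.
have e2 : 2 * ('i * (sin x * cos x)%:C * (cos x -i* sin x)) = (cos x -i* sin x) * ('i * (sin (2 * x))%:C).
  rewrite [2 * x]mulr_natl sin_mulr2n mulr2n rmorphD /= [cos x * sin x]mulrC; ring.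
rewrite e1; set P := ((a == b') && _)%:R; set Q := ((a == a') && _)%:R.
set X := _ * _%:C * _ in e2 *; set w := (_ -i* _) in e2 *.
transitivity (w * (cos (2 * x))%:C * Q + 2 * X * P); first by ring.
by rewrite e2; ring.
Qed.

Lemma rhoB_pswap m n (x : R) (phi : 'M[C]_(2, m)) (psi : 'M[C]_(2, n)) :
  let M := pswap (cos (2 * x)) (sin (2 * x)) phi psi in
  rhoB (Uop x) phi psi = M *m adjmx M.
Proof.
move=> M; apply: idxmxP => b t b' t'.
rewrite /rhoB mxE sum_mxvec_index summxE; apply: eq_bigr => a _.
rewrite summxE; apply: eq_bigr => r _.
rewrite adjmxE; set K := (X in _ = X).
rewrite mxE big_ord1 [_^T _ _]mxE [map_mx _ _ _ _]mxE !mxvecE.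
rewrite ![(\matrix_(_, _) _) _ _]mxE.
have w1 : (cos x -i* sin x) * conjc (cos x -i* sin x) = 1 :> C.
  by rewrite mulc_conj /nsq /= sqrrN cos2Dsin2.
have oE b0 t0 : out (Uop x) phi psi a r b0 t0 = (cos x -i* sin x) * M (mxvec_index b0 t0) (mxvec_index a r).
  rewrite /M /pswap idxmxE /out !big_ord_recl !big_ord0 !Uop_swap.
  by case: (ord2E a) => ->; case: (ord2E b0) => -> /=; ring.
by rewrite !oE rmorphM mulrACA w1 mul1r.
Qed.

End PartialSwap.

(** * Schmidt vectors and rotation of the frame *)

Section Frame.
Context {R : realType}.
Local Notation C := R[i].

(* Zero rows of [Y] stay zero, since [0^-1 = 0]; hence a partial isometry only. *)
Lemma row_normalize k n (Y : 'M[C]_(k, n)) (b := fun i => \sum_t nsq (Y i t)) :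
  Y *m adjmx Y = diag_mx (\row_i (b i)%:C) ->
  exists Z : 'M[C]_(k, n), [/\ Y *m adjmx Z = diag_mx (\row_i (Num.sqrt (b i))%:C),
    Z *m adjmx Z *m Z = Z & Y *m adjmx Z *m Z = Y].
Proof.
move=> YY.
have b0 i : 0 <= b i by apply: sumr_ge0 => t _; exact: nsq_ge0.
pose D := diag_mx (\row_i (Num.sqrt (b i))^-1%:C) : 'M[C]_k.
have DD : adjmx D = D.
  apply/matrixP => i j; rewrite adjmxE !mxE eq_sym.
  by case: eqP => [->|_]; rewrite ?mulr1n ?mulr0n ?conjc0 ?conjc_real.
pose Z := D *m Y.
have YZ : Y *m adjmx Z = diag_mx (\row_i (Num.sqrt (b i))%:C).
  rewrite /Z adjmxM DD mulmxA YY mulmx_diag; congr diag_mx; apply/rowP => i.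
  rewrite !mxE -rmorphM /=; congr (_%:C).
  have [bi|bi] := eqVneq (b i) 0; first by rewrite bi sqrtr0 mul0r.
  by rewrite -{1}(sqr_sqrtr (b0 i)) expr2 mulfK// sqrtr_eq0 -ltNge lt_def bi b0.
have YZZ : Y *m adjmx Z *m Z = Y.
  rewrite YZ /Z mulmxA mulmx_diag; apply/matrixP => i j.
  rewrite mul_diag_mx !mxE -rmorphM /=.
  have [bi|bi] := eqVneq (b i) 0; last first.
    by rewrite mulfV ?mul1r// sqrtr_eq0 -ltNge lt_def bi b0.
  have /eqP : b i = 0 by [].
  rewrite psumr_eq0 => [|t _]; last exact: nsq_ge0.
  move=> /allP/(_ j); rewrite mem_index_enum => /(_ isT)/implyP/(_ isT).
  rewrite /nsq paddr_eq0 ?sqr_ge0// !sqrf_eq0.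
  by case: (Y i j) => x y /= /andP[/eqP -> /eqP ->]; rewrite mulr0.
exists Z; split => //.
by rewrite {1}/Z -[D *m Y *m _]mulmxA -mulmxA YZZ.
Qed.

(** The direct sum of [Z] on the span of [e_0 e_0], [e_1 e_1] and of the identity on [e_0 e_1],
    [e_1 e_0]. *)
Definition blockrot (Z : 'M[C]_2) : 'M[C]_(2 * 2) :=
  idxmx (fun k l k' l' => if k == l then (if k' == l' then Z k k' else 0)
                          else ((k == k') && (l == l'))%:R).

Lemma blockrot_unitary (Z : 'M[C]_2) : Z *m adjmx Z = 1%:M ->
  blockrot Z *m adjmx (blockrot Z) = 1%:M.
Proof.
move=> ZZ.
have E k k' : Z k ord0 * conjc (Z k' ord0) + Z k (lift ord0 ord0) * conjc (Z k' (lift ord0 ord0)) = (k == k')%:R.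
  have := congr1 (fun A : 'M[C]_2 => A k k') ZZ.
  by rewrite !mxE !big_ord_recl big_ord0 !adjmxE addr0.
apply: idxmxP => k l k' l'; rewrite scalar_mxvec_index mxE sum_mxvec_index.
rewrite !big_ord_recl !big_ord0 !adjmxE !idxmxE !(fun_if (@conjc R)) !conjc0 !conjc_nat.
have [<-|kl] := eqVneq k l; have [<-|kl'] := eqVneq k' l'.
- rewrite andbb -E /=; ring.
- case: (ord2E k) => ->; case: (ord2E k') kl' => ->; case: (ord2E l') => -> //= _; ring.
- case: (ord2E k) kl => ->; case: (ord2E l) => -> //= _; case: (ord2E k') => ->;
    rewrite /=; ring.
- case: (ord2E k) kl => ->; case: (ord2E l) => -> //= _; case: (ord2E k') kl' => ->; case: (ord2E l') => -> //= _;
    rewrite /=; ring.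
Qed.

Lemma blockrot_offdiag p (Z : 'M[C]_2) (F : 'M[C]_(2 * 2, p)) k l j : k != l ->
  (blockrot Z *m F) (mxvec_index k l) j = F (mxvec_index k l) j.
Proof.
move=> kl; rewrite mxE sum_mxvec_index !big_ord_recl !big_ord0 !idxmxE.
by case: (ord2E k) kl => ->; case: (ord2E l) => -> //= _; ring.
Qed.

Lemma blockrot_diag p (Z : 'M[C]_2) (F : 'M[C]_(2 * 2, p)) k j :
  (blockrot Z *m F) (mxvec_index k k) j =
  (Z *m \matrix_(k, j) F (mxvec_index k k) j) k j.
Proof.
rewrite !mxE sum_mxvec_index !big_ord_recl !big_ord0 !idxmxE !mxE eqxx /=.
ring.
Qed.

End Frame.

(** * Entropy bound for an arbitrary product input *)

Section UpperBound.
Context {R : realType}.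
Local Notation C := R[i].
Implicit Types (c s : R).

Lemma det2 (A : 'M[C]_2) :
  \det A = A ord0 ord0 * A (lift ord0 ord0) (lift ord0 ord0)
         - A ord0 (lift ord0 ord0) * A (lift ord0 ord0) ord0.
Proof.
rewrite (expand_det_row _ ord0) !big_ord_recl big_ord0 /cofactor !det_mx11 !mxE.
have -> : lift (lift ord0 ord0) 0 = ord0 :> 'I_2 by exact: val_inj.
by rewrite /= /bump /= !addn0 ?add0n expr0 expr1; ring.
Qed.

Lemma tr2 (A : 'M[C]_2) : \tr A = A ord0 ord0 + A (lift ord0 ord0) (lift ord0 ord0).
Proof. by rewrite /mxtrace !big_ord_recl big_ord0 addr0. Qed.

Lemma normalized_rows k m (X : 'M[C]_k) (phi : 'M[C]_(k, m)) : X *m adjmx X = 1%:M ->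
  \sum_a \sum_r phi a r * conjc (phi a r) = 1 ->
  \sum_k \sum_r nsq ((X *m phi) k r) = 1.
Proof.
move=> XX phi1; have XX' : adjmx X *m X = 1%:M by exact: mulmx1C.
apply: (@complexI R); rewrite -[RHS]phi1 rmorph_sum /=.
transitivity (\tr (X *m phi *m adjmx (X *m phi))).
  by apply: eq_bigr => i _; rewrite mulmx_adj_diag.
rewrite adjmxM mulmxA mxtrace_mulC !mulmxA XX' mul1mx.
apply: eq_bigr => a _; rewrite mxE; apply: eq_bigr => r _.
by rewrite adjmxE.
Qed.

Section Block.
Context (c s : R) (m : nat) (phi : 'M[C]_(2, m)) (b : 'I_2 -> R).
Context (cs : c ^+ 2 + s ^+ 2 = 1) (b0 : forall k, 0 <= b k).
Let i1 : 'I_2 := lift ord0 ord0.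
Let a k := \sum_r nsq (phi k r).
Let F := pswap c s phi (diag_mx (\row_k (Num.sqrt (b k))%:C)).
Let H := \matrix_(k, j) F (mxvec_index k k) j.

(** The second input is diagonal, so off the diagonal only the swapped term survives, and only in
    the column block [l]. *)
Lemma pswap_offdiag k l : k != l ->
  \sum_j nsq (F (mxvec_index k l) j) = s ^+ 2 * (a k * b l).
Proof.
move=> kl; rewrite sum_mxvec_index (bigD1 l)//= [X in _ + X]big1 ?addr0 => [|l' ll']; last first.
  rewrite big1// => r _; rewrite /F idxmxE !mxE (negPf kl) (negPf ll') !mulr0n !mulr0 addr0.
  by rewrite /nsq /= expr0n addr0.
rewrite [a k]/a mulr_suml mulr_sumr; apply: eq_bigr => r _.
rewrite /F idxmxE !mxE (negPf kl) eqxx mulr0n mulr1n !mulr0 add0r /nsq.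
rewrite -[b l in RHS]sqr_sqrtr//; case: (phi k r) => u v; simpc => /=.
by ring.
Qed.

Lemma pswap_block_gram k k' : (H *m adjmx H) k k' =
  (Num.sqrt (b k))%:C * (Num.sqrt (b k'))%:C *
  \sum_l (c%:C + 'i * s%:C *+ (k == l)) * conjc (c%:C + 'i * s%:C *+ (k' == l)) * (a l)%:C.
Proof.
rewrite mxE sum_mxvec_index mulr_sumr; apply: eq_bigr => l _.
rewrite rmorph_sum /= !mulr_sumr; apply: eq_bigr => r _.
have HE j : H j (mxvec_index l r) = (Num.sqrt (b j))%:C * (c%:C + 'i * s%:C *+ (j == l)) * phi l r.
  rewrite /H mxE /F idxmxE !mxE eqxx mulr1n.
  have [->|jl] := eqVneq j l; first by rewrite ?eqxx !mulr1n; ring.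
  by rewrite !mulr0n; ring.
by rewrite adjmxE !HE -mulc_conj !conjcM conjc_real; ring.
Qed.

Lemma pswap_block_tr : a ord0 + a i1 = 1 -> b ord0 + b i1 = 1 ->
  \tr (H *m adjmx H) = (1 - s ^+ 2 * (a ord0 * b i1 + a i1 * b ord0))%:C.
Proof.
move=> a1 b1; have sb k : (Num.sqrt (b k))%:C * (Num.sqrt (b k))%:C = (b k)%:C.
  by rewrite -rmorphM /= -expr2 sqr_sqrtr.
rewrite tr2 !pswap_block_gram !big_ord_recl !big_ord0 !sb /= !mulr1n !mulr0n !addr0.
rewrite !mulc_conj /nsq; simpc; rewrite /=.
have -> : a i1 = 1 - a ord0 by rewrite -a1; ring.
have -> : b i1 = 1 - b ord0 by rewrite -b1; ring.
have -> : c ^+ 2 = 1 - s ^+ 2 by rewrite -cs; ring.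
by congr (_ +i* _); ring.
Qed.

(** By [c^2 + s^2 = 1] the squares of [a_0] and [a_1] cancel, and [a_0 a_1] keeps the coefficient
    [1 - c^4 + 2 c^2 s^2 = s^2 (4 - 3 s^2)]. *)
Lemma pswap_block_det :
  \det (H *m adjmx H) =
  (s ^+ 2 * (4 - 3 * s ^+ 2) * ((a ord0 * b i1) * (a i1 * b ord0)))%:C.
Proof.
have sb k : (Num.sqrt (b k))%:C * (Num.sqrt (b k))%:C = (b k)%:C.
  by rewrite -rmorphM /= -expr2 sqr_sqrtr.
rewrite det2 !pswap_block_gram !sb.
set q0 := (Num.sqrt (b ord0))%:C; set q1 := (Num.sqrt _)%:C.
set S00 := \sum_l _; set S11 := \sum_l _; set S01 := \sum_l _; set S10 := \sum_l _.
rewrite (_ : _ - _ = (b ord0)%:C * (b i1)%:C * (S00 * S11 - S01 * S10)); last first.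
  by rewrite -!sb -/q0 -/q1; ring.
rewrite /S00 /S11 /S01 /S10 !big_ord_recl !big_ord0 /= !mulr1n !mulr0n !addr0.
rewrite !mulc_conj /nsq; simpc; rewrite /=.
have cE : c ^+ 2 = 1 - s ^+ 2 by rewrite -cs; ring.
congr (_ +i* _); last by rewrite -/i1; ring.
rewrite -/i1; transitivity (b ord0 * b i1 *
    (((c ^+ 2 + s ^+ 2) * a ord0 + c ^+ 2 * a i1) * (c ^+ 2 * a ord0 + (c ^+ 2 + s ^+ 2) * a i1)
     - c ^+ 2 * (s ^+ 2 * (a ord0 - a i1) ^+ 2 + c ^+ 2 * (a ord0 + a i1) ^+ 2))).
  by ring.
by rewrite cE; ring.
Qed.

End Block.

Lemma pswap_entropy_le c s m n (phi : 'M[C]_(2, m)) (psi : 'M[C]_(2, n)) e :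
  c ^+ 2 + s ^+ 2 = 1 -> s != 0 -> normalized phi -> normalized psi ->
  vn_entropy_is (pswap c s phi psi *m adjmx (pswap c s phi psi)) e ->
  e * ln 2 <= Num.max (entH2 (s ^+ 2)) (entH4 (s ^+ 2)).
Proof.
move=> cs sN0 phi1 psi1; set M := pswap c s phi psi => He.
have [X XX] := gram_diagonalize psi; set Y := X *m psi => YY.
have XX' : adjmx X *m X = 1%:M by exact: mulmx1C.
pose b k := \sum_t nsq (Y k t).
have b0 k : 0 <= b k by apply: sumr_ge0 => t _; exact: nsq_ge0.
have [Yh [YZ ZZZ YZZ]] := row_normalize YY.
(* Conjugated because the action on R_B enters [kron_pswap] through [Z^T], which has to be the
   adjoint of the Schmidt frame. *)
pose Z := map_mx (@conjc R) Yh.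
have ZT : Z^T = adjmx Yh by [].
have ZA : adjmx Z = Yh^T by apply/matrixP => i j; rewrite adjmxE !mxE conjcK.
pose phi' := X *m phi.
pose a k := \sum_r nsq (phi' k r).
have a0 k : 0 <= a k by apply: sumr_ge0 => t _; exact: nsq_ge0.
pose F := pswap c s phi' (diag_mx (\row_k (Num.sqrt (b k))%:C)).
pose E0 := kron X Z.
(* A unitary on A R_A, which leaves the reduced state of B R_B unchanged. *)
pose T : 'M[C]_(2 * m) := kron X^T 1%:M.
have TT : T *m adjmx T = 1%:M.
  rewrite /T kron_adj kron_mul adjmx1 mulmx1 -kron1; congr kron.
  have -> : adjmx X^T = (adjmx X)^T by apply/matrixP => i j; rewrite !mxE.
  by rewrite -trmx_mul XX' trmx1.
have EF : E0 *m M *m T = F by rewrite kron_pswap -/Y ZT YZ.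
have ZZ : Z *m adjmx Z *m Z = Z.
  apply: (can_inj (@adjmxK R _ _)); rewrite !adjmxM !adjmxK ZA mulmxA.
  by apply: trmx_inj; rewrite !trmx_mul !trmxK ZT mulmxA.
have EEE : E0 *m adjmx E0 *m E0 = E0.
  by rewrite /E0 kron_adj !kron_mul XX mul1mx ZZ.
(* The projection of R_B onto the span of the Schmidt vectors fixes [psi], hence the output. *)
have EEM : adjmx E0 *m E0 *m M = M.
  rewrite /E0 kron_adj kron_mul XX'.
  have := kron_pswap c s phi psi 1%:M (adjmx Z *m Z).
  rewrite trmx1 kron1 mulmx1 !mul1mx -/M => ->; congr pswap.
  have -> : psi = adjmx X *m Y by rewrite /Y mulmxA XX' mul1mx.
  by rewrite trmx_mul ZT ZA trmxK -mulmxA [Y *m _]mulmxA YZZ.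
pose H := \matrix_(k, j) F (mxvec_index k k) j.
have [W WW HW] := gram_diagonalize H.
have WW' : adjmx W *m W = 1%:M by exact: mulmx1C.
pose lam k := \sum_t nsq ((W *m H) k t).
pose G := blockrot W.
have GG : G *m adjmx G = 1%:M by exact: blockrot_unitary.
have GG' : adjmx G *m G = 1%:M by exact: mulmx1C.
pose E := G *m E0.
have hE1 : E *m adjmx E *m E = E.
  rewrite /E adjmxM !mulmxA -(mulmxA _ (adjmx G)) GG' mulmx1.
  by rewrite -!mulmxA [E0 *m (_ *m _)]mulmxA EEE.
have hE2 : adjmx E *m E *m M = M.
  by rewrite /E adjmxM -!mulmxA (mulmxA (adjmx G)) GG' mul1mx mulmxA EEM.
pose r i := \sum_j nsq ((G *m F) i j).
have hr i : (E *m M *m adjmx (E *m M)) i i = (r i)%:C.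
  rewrite -mulmx_adj_diag; congr (_ _ i i).
  have -> : G *m F = E *m M *m T by rewrite -EF /E !mulmxA.
  by rewrite [adjmx (_ *m T)]adjmxM mulmxA -(mulmxA _ T) TT mulmx1.
have := entropy_le_pinched hE1 hE2 hr He; move/le_trans; apply.
set i1 : 'I_2 := lift ord0 ord0.
have rd k : r (mxvec_index k k) = lam k.
  by apply: eq_bigr => j _; rewrite blockrot_diag.
have ro k l : k != l -> r (mxvec_index k l) = s ^+ 2 * (a k * b l).
  move=> kl; rewrite -(pswap_offdiag c s phi' b0 kl); apply: eq_bigr => j _.
  by rewrite blockrot_offdiag.
have a1 : a ord0 + a i1 = 1.
  by have := normalized_rows XX phi1; rewrite !big_ord_recl big_ord0 addr0.
have b1 : b ord0 + b i1 = 1.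
  by have := normalized_rows XX psi1; rewrite !big_ord_recl big_ord0 addr0.
(* The numbers [lam] are the eigenvalues of the Gram matrix of [H], so its trace and determinant
   give their sum and product. *)
have WH : W *m H *m adjmx (W *m H) = W *m (H *m adjmx H) *m adjmx W by rewrite adjmxM !mulmxA.
have lS : lam ord0 + lam i1 = 1 - s ^+ 2 * (a ord0 * b i1 + a i1 * b ord0).
  apply: (@complexI R); rewrite -(pswap_block_tr cs b0 a1 b1) -/F -/H.
  rewrite -[H *m _]mul1mx -WW' -mulmxA mxtrace_mulC -WH HW tr2 !mxE /= !mulr1n.
  by rewrite rmorphD.
have lP : lam ord0 * lam i1 = s ^+ 2 * (4 - 3 * s ^+ 2) * ((a ord0 * b i1) * (a i1 * b ord0)).
  apply: (@complexI R); rewrite -(@pswap_block_det c s m phi' b cs b0) -/F -/H.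
  have : \det (W *m (H *m adjmx H) *m adjmx W) = \det (H *m adjmx H).
    by rewrite !det_mulmx mulrAC -det_mulmx WW det1 mul1r.
  move=> <-; rewrite -WH HW det2 !mxE /= !mulr1n !mulr0n mulr0 subr0.
  by rewrite rmorphM.
rewrite sum_mxvec_index !big_ord_recl !big_ord0 -/i1 !rd !ro// !addr0.
rewrite addrACA addrC addrA [ent (s ^+ 2 * _) + _]addrC.
have lam0 k : 0 <= lam k by apply: sumr_ge0 => t _; exact: nsq_ge0.
have s2 : 0 < s ^+ 2 <= 1.
  by rewrite exprn_even_gt0//= sN0 -cs lerDr sqr_ge0.
apply: le_trans (entropy_le_max s2 _ _ _ _ _ _ lS lP) => //; rewrite ?mulr_ge0//.
- lra.
- have -> : b i1 = 1 - b ord0 by lra.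
  have -> : a i1 = 1 - a ord0 by lra.
  have := a0 ord0; have := a0 i1; have := b0 ord0; have := b0 i1; nra.
- rewrite -subr_ge0 (_ : _ - _ = (a ord0 * b ord0 - a i1 * b i1) ^+ 2) ?sqr_ge0//.
  have -> : b i1 = 1 - b ord0 by lra.
  have -> : a i1 = 1 - a ord0 by lra.
  by ring.
Qed.

End UpperBound.

(** * Optimal inputs *)

Section Attained.
Context {R : realType}.
Local Notation C := R[i].
Implicit Types (c s x : R).

Lemma shannon_enum_index m n (f : 'I_m -> 'I_n -> R) :
  shannon [seq mxvec (\matrix_(a, b) f a b) 0 i | i <- enum 'I_(m * n)] * ln 2 =
  \sum_a \sum_b ent (f a b).
Proof.
rewrite shannonE big_map enumT sum_mxvec_index.
by apply: eq_bigr => a _; apply: eq_bigr => b _; rewrite mxvecE mxE.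
Qed.

Lemma vn_entropy_is_frame m n p (G : 'M[C]_(m * n)) (M : 'M[C]_(m * n, p)) (f : 'I_m -> 'I_n -> R) e :
  G *m adjmx G = 1%:M ->
  (forall a b a' b', (G *m M *m adjmx (G *m M)) (mxvec_index a b) (mxvec_index a' b') =
     (f a b)%:C *+ ((a == a') && (b == b'))) ->
  e * ln 2 = \sum_a \sum_b ent (f a b) ->
  vn_entropy_is (M *m adjmx M) e.
Proof.
move=> GG GM eE; have GG' : adjmx G *m G = 1%:M by exact: mulmx1C.
exists (adjmx G), (mxvec (\matrix_(a, b) f a b)); split; first by rewrite adjmxK.
split; last first.
  have ln2 : ln 2 != 0 :> R by rewrite gt_eqF// ln_gt0// ltr1n.
  by apply: (mulIf ln2); rewrite shannon_enum_index.
rewrite adjmxK.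
have <- : G *m M *m adjmx (G *m M) = diag_mx (map_mx (fun t : R => t%:C) (mxvec (\matrix_(a, b) f a b))).
  apply: idxmxP => a b a' b'; rewrite GM mxE mxvec_index_eq.
  by rewrite [map_mx _ _ _ _]mxE mxvecE mxE.
by rewrite adjmxM !mulmxA GG' mul1mx -!mulmxA GG' mulmx1.
Qed.

Lemma H2E x : H2 x * ln 2 = entH2 (sin (2 * x) ^+ 2).
Proof.
by rewrite /H2 shannonE !big_cons big_nil addr0 /entH2 cos2sin2.
Qed.

(** With [cos^2 x + sin^2 x = 1], [cos^6 x + sin^6 x = 1 - 3 cos^2 x sin^2 x]. *)
Lemma H4E x : H4 x * ln 2 = entH4 (sin (2 * x) ^+ 2).
Proof.
rewrite /H4 shannonE !big_cons big_nil addr0 /entH4.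
have c2 := cos2Dsin2 x.
have e1 : cos x ^+ 2 * sin x ^+ 2 = sin (2 * x) ^+ 2 / 4.
  by rewrite mulr_natl sin_mulr2n; field.
have -> : cos x ^+ 6 + sin x ^+ 6 = 1 - 3 / 4 * sin (2 * x) ^+ 2.
  rewrite (_ : 3 / 4 * _ = 3 * (cos x ^+ 2 * sin x ^+ 2)); last by rewrite e1; field.
  have -> : cos x ^+ 2 = 1 - sin x ^+ 2 by rewrite -c2; ring.
  rewrite (_ : cos x ^+ 6 = (cos x ^+ 2) ^+ 3); last by ring.
  have -> : cos x ^+ 2 = 1 - sin x ^+ 2 by rewrite -c2; ring.
  by ring.
by rewrite e1; ring.
Qed.

Lemma pswap_ket_entropy c s e : e * ln 2 = ent (c ^+ 2) + ent (s ^+ 2) ->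
  vn_entropy_is (pswap c s ket00 ket11 *m adjmx (pswap c s ket00 ket11)) e.
Proof.
move=> eE.
(* The ancilla of B stays in state 1, while the qubit B holds 1 with weight [c^2] and 0, after a
   swap, with weight [s^2]; the standard basis already diagonalizes. *)
apply: (@vn_entropy_is_frame _ _ _ 1%:M _
  (fun b t => if t == ord0 then 0 else if b == ord0 then s ^+ 2 else c ^+ 2)).
- by rewrite adjmx1 mulmx1.
- have ME b t a r : pswap c s ket00 ket11 (mxvec_index b t) (mxvec_index a r) =
      if (t != ord0) && (r == ord0) && (a != b) then (if a == ord0 then c%:C else 'i * s%:C) else 0.
    rewrite idxmxE /ket00 /ket11 !mxE ord_max2.
    by case: (ord2E b) => ->; case: (ord2E t) => ->; case: (ord2E a) => ->; case: (ord2E r) => -> /=;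
      rewrite ?(mulr0, mul0r, mulr1, addr0, add0r).
  move=> b t b' t'; rewrite !mul1mx mxE sum_mxvec_index.
  rewrite !big_ord_recl !big_ord0 !adjmxE !ME.
  have KK : ('i * s%:C) * conjc ('i * s%:C) = (s ^+ 2)%:C.
    by rewrite conjcM mulrACA conjc_real mulc_conj /nsq /= expr0n expr1n add0r mul1r -rmorphM.
  have LL : c%:C * conjc c%:C = (c ^+ 2)%:C by rewrite conjc_real -rmorphM.
  move: ('i * s%:C) c%:C KK LL => K L KK LL; rewrite !(fun_if (@conjc R)) !conjc0.
  case: (ord2E b) => ->; case: (ord2E t) => ->; case: (ord2E b') => ->; case: (ord2E t') => -> /=;
    rewrite ?(mulr0, mul0r, addr0, add0r, mulr0n, mulr1n, KK, LL)//.
- rewrite !big_ord_recl !big_ord0 /= !ent0 eE; ring.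
Qed.

Lemma bellE (k r : 'I_2) : bell k r = (Num.sqrt (1 / 2 : R))%:C *+ (k == r).
Proof.
rewrite /bell !mxE ord_max2.
by case: (ord2E k) => ->; case: (ord2E r) => -> /=;
  rewrite ?(mulr1n, mulr0n, addr0, add0r, mulr1, mulr0).
Qed.

Lemma pswap_bell_entropy c s e : c ^+ 2 + s ^+ 2 = 1 -> e * ln 2 = entH4 (s ^+ 2) ->
  vn_entropy_is (pswap c s bell bell *m adjmx (pswap c s bell bell)) e.
Proof.
move=> cs eE.
set q := Num.sqrt (1 / 2 : R).
have qq : q ^+ 2 = 1 / 2 by rewrite sqr_sqrtr//; lra.
(* The Hadamard matrix: the rotated frame contains the vectors [(|00> +- |11>) / sqrt 2]. *)
pose Z : 'M[C]_2 := \matrix_(k, j) (if (k != ord0) && (j != ord0) then - q else q)%:C.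
have ZZ : Z *m adjmx Z = 1%:M.
  apply/matrixP => k k'; rewrite !mxE !big_ord_recl big_ord0 !adjmxE !mxE.
  case: (ord2E k) => ->; case: (ord2E k') => -> /=; simpc; congr (_ +i* _); lra.
have GG := blockrot_unitary ZZ.
apply: (@vn_entropy_is_frame _ _ _ _ _
  (fun k l => if (k == ord0) && (l == ord0) then 1 - 3 / 4 * s ^+ 2 else s ^+ 2 / 4) _ GG).
- pose L : C := (c / 2)%:C; pose K : C := 'i * (s / 2)%:C.
  have QQ : q%:C * q%:C = (1 / 2)%:C by rewrite -rmorphM /= -expr2 qq.
  have ME b t a r : pswap c s bell bell (mxvec_index b t) (mxvec_index a r) =
      L *+ ((a == r) && (b == t)) + K *+ ((b == r) && (a == t)).
    have LE : c%:C * (q%:C * q%:C) = L by rewrite QQ -rmorphM /= mul1r.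
    have KE' : 'i * s%:C * (q%:C * q%:C) = K by rewrite QQ -mulrA -rmorphM /= mul1r.
    rewrite idxmxE !bellE -/q.
    by case: (a == r); case: (b == t); case: (b == r); case: (a == t);
      rewrite /= ?(mulr1n, mulr0n, mulr0, mul0r, LE, KE').
  (* [P] and [J] are, up to sign, the amplitudes along the plus and minus vectors; each occurs in
     the two columns with [a = r], hence the doubled squares below. *)
  pose P := q%:C * (2 * L + K); pose J := q%:C * K.
  have NE k l a r : (blockrot Z *m pswap c s bell bell) (mxvec_index k l) (mxvec_index a r) =
      if k == l then (if a == r then (if k == ord0 then P else if a == ord0 then J else - J) else 0)
      else if (k == r) && (l == a) then K else 0.
    have [<-|kl] := eqVneq k l; last by rewrite blockrot_offdiag// ME (negPf kl) andbF mulr0n add0r (eq_sym a) mulrb.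
    have HE j : (\matrix_(k, j) pswap c s bell bell (mxvec_index k k) j) j (mxvec_index a r) =
        L *+ (a == r) + K *+ ((j == r) && (a == j)).
      by rewrite mxE ME eqxx andbT.
    have ZE i j : Z i j = (if (i != ord0) && (j != ord0) then - q else q)%:C by rewrite mxE.
    rewrite blockrot_diag mxE !big_ord_recl big_ord0 !HE !ZE /P /J.
    by case: (ord2E k) => ->; case: (ord2E a) => ->; case: (ord2E r) => -> /=;
      rewrite ?(mulr1n, mulr0n, rmorphN); ring.
  have KK : K * conjc K = (s ^+ 2 / 4)%:C.
    rewrite conjcM mulrACA conjc_real mulc_conj /nsq /= expr0n expr1n add0r mul1r -rmorphM /=.
    by congr (_%:C); field.
  have PP : P * conjc P + P * conjc P = (1 - 3 / 4 * s ^+ 2)%:C.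
    have nE : nsq P = q ^+ 2 * (c ^+ 2 + s ^+ 2 / 4).
      by rewrite /P /L /K /nsq; simpc => /=; field.
    rewrite mulc_conj -rmorphD /= nE qq; congr (_%:C).
    by rewrite (_ : c ^+ 2 = 1 - s ^+ 2); [field|rewrite -cs; ring].
  have JJ : J * conjc J + J * conjc J = (s ^+ 2 / 4)%:C.
    rewrite conjcM mulrACA conjc_real QQ KK -rmorphM -rmorphD /=.
    by congr (_%:C); field.
  clearbody P J K.
  move=> k l k' l'; rewrite mxE sum_mxvec_index !big_ord_recl !big_ord0 !adjmxE !NE.
  rewrite !(fun_if (@conjc R)) !conjc0 !(rmorphN (@conjc R)).
  case: (ord2E k) => ->; case: (ord2E l) => ->; case: (ord2E k') => ->; case: (ord2E l') => -> /=;
    rewrite ?(mulr0, mul0r, addr0, add0r, mulr0n, mulr1n, mulNr, mulrN, opprK, subrr, addNr, KK, PP, JJ)//.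
- rewrite !big_ord_recl !big_ord0 /= eE /entH4; ring.
Qed.

End Attained.

(** * Entangling power on both sides of the crossing *)

Section Threshold.
Context {R : realType}.
Implicit Types x : R.

Lemma sqr_sin2_homo x y : 0 < x -> x <= y -> y <= pi / 4 ->
  0 < sin (2 * x) /\ sin (2 * x) ^+ 2 <= sin (2 * y) ^+ 2.
Proof.
move=> x0 xy y4.
have sp : 0 < sin (2 * x) by apply: sin_gt0_pi; have := @pi_gt0 R; lra.
have sy : 0 < sin (2 * y) by apply: sin_gt0_pi; have := @pi_gt0 R; lra.
split=> //; rewrite ler_sqr ?nnegrE ?(ltW sp) ?(ltW sy)//.
by rewrite leNgt ltr_sin ?in_itv/= -?leNgt; have := @pi_gt0 R; lra.
Qed.

(** The entropy bound holds for ancillas of every dimension, so a reachable value equal to it is the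
    supremum. *)
Lemma KE_max x (v : R) : 0 < sin (2 * x) ->
  achievable (Uop x) v ->
  v * ln 2 = Num.max (entH2 (sin (2 * x) ^+ 2)) (entH4 (sin (2 * x) ^+ 2)) ->
  KE (Uop x) = v%:E.
Proof.
move=> sp av vE; have ln2 : 0 < ln 2 :> R by rewrite ln_gt0// ltr1n.
apply/eqP; rewrite eq_le; apply/andP; split; last first.
  by apply: ereal_sup_ubound; exists v.
apply: ge_ereal_sup => _ [e [m [n [phi [psi [phi1 [psi1 He]]]]]] <-].
rewrite rhoB_pswap in He; rewrite lee_fin -(ler_pM2r ln2) vE.
by apply: pswap_entropy_le He => //; rewrite ?cos2Dsin2// gt_eqF.
Qed.

Lemma normalized_delta (a r : 'I_2) : normalized (delta_mx a r : 'M[R[i]]_2).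
Proof.
rewrite /normalized (bigD1 a)//= (bigD1 r)//= !big1 ?addr0.
- by rewrite mxE !eqxx conjc1 mulr1.
- by move=> i ia; rewrite big1// => j _; rewrite mxE (negPf ia) mul0r.
- by move=> j jr; rewrite mxE (negPf jr) andbF mul0r.
Qed.

Lemma normalized_bell : normalized (@bell R).
Proof.
have q2 : Num.sqrt (1 / 2 : R) ^+ 2 = 1 / 2 by rewrite sqr_sqrtr; lra.
have bb (a r : 'I_2) : bell a r * conjc (bell a r) = (1 / 2 : R)%:C%C *+ (a == r).
  rewrite bellE; case: (a == r); last by rewrite !mulr0n mul0r.
  by rewrite !mulr1n conjc_real -rmorphM /= -expr2 q2.
rewrite /normalized; under eq_bigr do under eq_bigr do rewrite bb.
rewrite !big_ord_recl !big_ord0 /= !mulr0n !mulr1n !addr0 add0r -rmorphD /=.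
by congr (_%:C)%C; field.
Qed.

End Threshold.

Theorem theorem2 (R : realType) (x0 x : R) :
  0 < x0 -> x0 <= pi / 4 -> H2 x0 = H4 x0 ->
  0 < x -> x <= pi / 4 ->
  (x <= x0 ->
     KE (Uop x) = (H2 x)%:E /\ vn_entropy_is (rhoB (Uop x) ket00 ket11) (H2 x)) /\
  (x0 <= x ->
     KE (Uop x) = (H4 x)%:E /\ vn_entropy_is (rhoB (Uop x) bell bell) (H4 x)).
Proof.
move=> x00 x04 E x_gt0 x4.
have [s0 _] := sqr_sin2_homo x00 (lexx _) x04.
have [s _] := sqr_sin2_homo x_gt0 (lexx _) x4.
have in01 (y : R) : 0 < sin (2 * y) -> 0 < sin (2 * y) ^+ 2 <= 1.
  by move=> sy; rewrite exprn_gt0//= -(cos2Dsin2 (2 * y)) lerDr sqr_ge0.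
have cross : entH2 (sin (2 * x0) ^+ 2) = entH4 (sin (2 * x0) ^+ 2).
  by rewrite -H2E -H4E E.
have [H42 H24] := entH_crossing (in01 _ s0) cross (in01 _ s).
split=> xx0.
  have vn : vn_entropy_is (rhoB (Uop x) ket00 ket11) (H2 x).
    by rewrite rhoB_pswap; apply: pswap_ket_entropy; rewrite H2E /entH2 cos2sin2.
  split=> //; apply: KE_max => //.
    by exists 2, 2, ket00, ket11; split; [|split] => //; exact: normalized_delta.
  by rewrite H2E max_l// H42// (sqr_sin2_homo x_gt0 xx0 x04).2.
have vn : vn_entropy_is (rhoB (Uop x) bell bell) (H4 x).
  by rewrite rhoB_pswap; apply: pswap_bell_entropy; rewrite ?cos2Dsin2 ?H4E.
split=> //; apply: KE_max => //.
  by exists 2, 2, bell, bell; split; [|split] => //; exact: normalized_bell.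
by rewrite H4E max_r// H24// (sqr_sin2_homo x00 xx0 x4).2.
Qed.
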